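(* Let $K$ be a field, let $n\ge 2$ and $1\le a<n$ be integers, and let $t=\gcd(2n,a)$. Let $G=C_{2n}(a,n)$ be the cubic circulant graph, and let $I(G)\subset K[V(G)]$ be its edge ideal. (a) If $\frac{2n}{t}$ is even, then $$\operatorname{pdim}\big(K[V(G)]/I(G)\big)=\begin{cases}2n-\left\lceil\frac{n}{2t}\right\rceil\cdot t, & \text{if } \frac{n}{t}\equiv 1 \pmod 4,\\[1ex] 2n-\left\lceil\frac{n-t}{2t}\right\rceil\cdot t, & \text{otherwise.}\end{cases}$$ (b) If $\frac{2n}{t}$ is odd, then $$\operatorname{pdim}\big(K[V(G)]/I(G)\big)=\begin{cases}2n-\left\lceil\frac{2n-t}{2t}\right\rceil\cdot \frac{t}{2}, & \text{if } \frac{2n}{t}\equiv 1 \pmod 4,\\[1ex] 2n-\left\lceil\frac{n}{t}\right\rceil\cdot \frac{t}{2}, & \text{if } \frac{2n}{t}\equiv 3 \pmod 4.\end{cases}$$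
   Context: For a finite simple graph $G$, $K[V(G)]$ is the polynomial ring over $K$ (standard grading) whose variables are the vertices of $G$, and the edge ideal is $I(G)=(uv : \{u,v\}\in E(G))$. $\operatorname{pdim}$ denotes projective dimension over $K[V(G)]$, i.e. the length of the minimal graded free resolution. For $q\ge 2$ and a subset $\mathbb{S}\subseteq\{1,\dots,\lfloor q/2\rfloor\}$, the circulant graph $C_q(\mathbb{S})$ is the graph on vertices $x_1,\dots,x_q$ in which $\{x_i,x_j\}$ ($i\neq j$) is an edge if and only if $|i-j|\in \mathbb{S}$ or $q-|i-j|\in \mathbb{S}$; $C_{2n}(a,n)$ denotes $C_{2n}(\{a,n\})$. *)

(* Defs.v *)
From HB Require Import structures.
From mathcomp Require Export all_boot all_order all_algebra.
From mathcomp Require Export mpoly.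

Set Implicit Arguments.
Unset Strict Implicit.
Unset Printing Implicit Defensive.

Import GRing.Theory.

Local Open Scope ring_scope.

Record sgraph (N : nat) := SGraph {
  adj :> rel 'I_N;
  adj_sym : ssrbool.symmetric adj;
  adj_irr : irreflexive adj }.

(* The vertex x_(i+1) is i : 'I_q; only the differences of indices matter.
   The difference q - `|i - j| never truncates, since `|i - j| < q. *)
Definition circulant_adj (q : nat) (S : seq nat) : rel 'I_q :=
  fun i j => (i != j) && ((`|i - j|%N \in S) || ((q - `|i - j|)%N \in S)).

Fact circulant_adj_sym q S : ssrbool.symmetric (@circulant_adj q S).
Proof. by move=> i j; rewrite /circulant_adj eq_sym distnC. Qed.

Fact circulant_adj_irr q S : irreflexive (@circulant_adj q S).
Proof. by move=> i; rewrite /circulant_adj eqxx. Qed.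

Definition circulant (q : nat) (S : seq nat) : sgraph q :=
  SGraph (@circulant_adj_sym q S) (@circulant_adj_irr q S).

(* K[V(G)] is {mpoly K[N]}, an ideal is its membership predicate. *)
Definition edge_ideal (K : fieldType) (N : nat) (G : sgraph N)
    (f : {mpoly K[N]}) : Prop :=
  exists c : 'I_N -> 'I_N -> {mpoly K[N]},
    f = \sum_(i < N) \sum_(j < N | G i j) c i j * ('X_i * 'X_j).

(* Data of a complex of finitely generated graded free modules over
   R = {mpoly K[N]}, together with an augmentation F_0 -> R lifting a map to a
   quotient R / I.  Here F_i is the sum of the R(- shift i j), j < rk i, its
   elements are row vectors, and maps act by right multiplication:
   diff i is the map F_(i+1) -> F_i. *)
Record gfree (K : fieldType) (N : nat) := GFree {
  rk : nat -> nat;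
  shift : forall i, 'I_(rk i) -> nat;
  diff : forall i, 'M[{mpoly K[N]}]_(rk i.+1, rk i);
  aug : 'cV[{mpoly K[N]}]_(rk 0) }.

Section Resolution.

Variables (K : fieldType) (N : nat).
Implicit Types (I : {mpoly K[N]} -> Prop) (F : gfree K N).

(* All maps are homogeneous of degree 0 (a zero entry is unconstrained). *)
Definition graded F : Prop :=
  (forall j m, m \in msupp (aug F j 0) -> mdeg m = shift j)
  /\ (forall i j k m, m \in msupp (diff F i j k) ->
        (mdeg m + shift k)%N = shift j).

(* F_(i+2) -> F_(i+1) -> F_i is exact for all i, and so is
   F_1 -> F_0 -> R / I -> 0. *)
Definition resolves I F : Prop :=
  [/\ forall f : {mpoly K[N]},
        exists u : 'rV_(rk F 0), I (f - (u *m aug F) 0 0),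
      forall u : 'rV_(rk F 0),
        I ((u *m aug F) 0 0) <-> exists v, u = v *m diff F 0
    & forall i (u : 'rV_(rk F i.+1)),
        u *m diff F i = 0 <-> exists v, u = v *m diff F i.+1].

(* The entries of the differentials lie in the ideal (x_1, ..., x_N). *)
Definition minimal F : Prop :=
  forall i j k, (diff F i j k)@_0%MM = 0.

Definition min_graded_free_resolution I F : Prop :=
  [/\ graded F, resolves I F & minimal F].

Definition has_length F (p : nat) : Prop :=
  (0 < rk F p)%N /\ (forall i, (p < i)%N -> rk F i = 0%N).

(* pdim (R / I) = p, for a proper homogeneous ideal I.  The minimal graded
   free resolution is unique up to isomorphism, so at most one p qualifies. *)
Definition pdim_quot I (p : nat) : Prop :=
  exists2 F, min_graded_free_resolution I F & has_length F p.

End Resolution.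

(* Main.v *)
Require Import Defs.
From mathcomp Require Import all_boot all_order all_algebra mpoly.
From mathcomp Require Import zify ring lra.
From Stdlib Require Import ClassicalEpsilon.

Set Implicit Arguments.
Unset Strict Implicit.
Unset Printing Implicit Defensive.

Import GRing.Theory.
Local Open Scope ring_scope.

(** The projective dimension of R/I is the largest p for which the Koszul
    homology H_p(x_1, ..., x_N; R/I) is nonzero.  This homology can be followed
    by hand on edge ideals, which gives both bounds.

    Resolutions.  For a graded submodule M of a free module, choose a system of
    homogeneous generators with as few elements as possible.  It exists because
    the Koszul homology of M in homological degree zero is M/mM, and here it
    vanishes in large degrees (nakayama, low_degree_generators); it is minimal
    because a relation with an invertible coefficient would make a generator
    redundant (drop_generator).  The kernel of the presentation has the Koszul
    homology of M shifted by one (submod_exact_shift), so the construction can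
    be repeated, and its n-th free module is zero exactly if H_n(x; R/I) is
    (pdim_quot_koszul).

    Upper bound.  Let I be generated by the edges inside a vertex set W and by
    some further variables.  For x in W, the ideals I : x and (I, x) are of the
    same kind, for the link W - N[x] and for the deletion W - x, and the exact
    sequence relating the three quotients bounds the depth of R/I from below
    (quotient_exact_branch).  These branchings are recorded as derivations of
    the relation depth_bound, whose soundness is depth_bound_exact.

    Lower bound.  In the degree of the product of all variables, H_(N-d)(x; R/I)
    is the reduced cohomology of the independence complex on faces of size d.
    The long exact sequence of deletion and link propagates a nonzero class
    when the third term vanishes.  These steps are the relation nonvanishing,
    and depth_bound with the flag cone, where a set with an isolated vertex is
    acyclic altogether.

    Ladders.  With t = gcd(2n, a), the graph is the union of t Moebius ladders
    with n/t rungs if 2n/t is even, and of t/2 prisms with 2n/t rungs if 2n/t is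
    odd (steps_even, steps_odd, vertex_ladder).  Cutting a cyclic ladder at a
    vertex x and at a vertex y diagonal to it leaves strips with pendant end
    vertices.  Branching a strip at the neighbour of a pendant vertex shortens
    it by one or two columns and moves the pendant vertex to the other rail, so
    depth and cohomology of strips have period four in their length.  Here the
    two bounds agree (ladder_depth_exact), and both add up over components. *)


(** * The Koszul differential *)

Section SignedSums.

Variables (R : comNzRingType) (V : lmodType R) (N : nat) (c : 'I_N -> R).
Implicit Types (S : {set 'I_N}) (v w x : 'I_N) (z : {set 'I_N} -> V).

Definition rank_in v S : nat := #|[set w in S | (w < v)%N]|.

Definition kd z S : V :=
  \sum_(v | v \notin S) ((-1) ^+ rank_in v S * c v) *: z (v |: S).

(** For z the coefficients of the sum of the z(S) e_S, the value at a set S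
    containing x is the coefficient of e_S in its exterior product with e_x. *)
Definition wedge x z S : V := (-1) ^+ rank_in x (S :\ x) *: z (S :\ x).

Lemma rank_inU1 v x S :
  x \notin S -> rank_in v (x |: S) = (rank_in v S + (x < v))%N.
Proof.
move=> xS; rewrite /rank_in.
have -> : [set w in x |: S | (w < v)%N] =
  if (x < v)%N then x |: [set w in S | (w < v)%N] else [set w in S | (w < v)%N].
  apply/setP=> w; case: ifP => xv; rewrite !inE; case: eqP => [->|] //=;
  by rewrite xv ?andbF.
case: ifP => xv; last by rewrite addn0.
by rewrite cardsU1 !inE (negbTE xS) /= addnC.
Qed.

Lemma sign_swap v x S : x != v -> x \notin S -> v \notin S ->
  (-1) ^+ rank_in v S * (-1) ^+ rank_in x (v |: S)
  = - ((-1) ^+ rank_in x S * (-1) ^+ rank_in v (x |: S)) :> R.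
Proof.
move=> xv xS vS; rewrite !rank_inU1 // !exprD.
have -> : (v < x)%N = ~~ (x < v)%N.
  by move: xv; rewrite -val_eqE /=; case: ltngtP.
case: (x < v)%N => /=; rewrite ?expr0 ?expr1; ring.
Qed.

(** Pairing (v, w) with (w, v) instead of comparing the sum with its opposite
    keeps characteristic two. *)
Lemma antisym_sum0 S (F : 'I_N -> 'I_N -> V) :
  (forall v w, v != w -> F v w = - F w v) ->
  \sum_(v | v \notin S) \sum_(w | w \notin v |: S) F v w = 0.
Proof.
move=> FN.
rewrite pair_big_dep /=.
rewrite (bigID (fun p : 'I_N * 'I_N => (p.1 < p.2)%N)) /=.
rewrite [X in _ + X](reindex_inj (h := fun p : 'I_N * 'I_N => (p.2, p.1))) /=;
  last by move=> [a b] [a' b'] [-> ->].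
rewrite [X in _ + X](eq_bigl (fun p : 'I_N * 'I_N =>
   [&& p.1 \notin S, p.2 \notin p.1 |: S & (p.1 < p.2)%N])); last first.
  move=> [a b] /=; rewrite !inE !negb_or -val_eqE -[b == a]val_eqE /=.
  by case: (a \in S); case: (b \in S); rewrite /= ?andbF ?andbT; lia.
rewrite (eq_bigl (fun p : 'I_N * 'I_N =>
   [&& p.1 \notin S, p.2 \notin p.1 |: S & (p.1 < p.2)%N])); last first.
  by move=> [a b] /=; rewrite andbA.
rewrite -big_split big1 //= => -[a b] /= /and3P[_ _ ab].
by rewrite FN ?addNr // neq_ltn ab.
Qed.

Lemma kd_kd z S : kd (kd z) S = 0.
Proof.
rewrite /kd.
rewrite (eq_bigr (fun v => \sum_(w | w \notin v |: S)
   (((-1) ^+ rank_in v S * c v) *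
    ((-1) ^+ rank_in w (v |: S) * c w)) *: z (w |: (v |: S)))); last first.
  by move=> v vS; rewrite scaler_sumr; apply: eq_bigr => w _; rewrite scalerA.
(* The summand is antisymmetric only for v and w outside S. *)
pose F v w := if (v \notin S) && (w \notin S) then
   (((-1) ^+ rank_in v S * c v) *
    ((-1) ^+ rank_in w (v |: S) * c w)) *: z (w |: (v |: S)) else 0.
rewrite -[RHS](@antisym_sum0 S F); last first.
  move=> v w vw; rewrite /F [in RHS]andbC; case: ifP => [/andP[vS wS]|_];
    last by rewrite oppr0.
  rewrite setUCA -scaleNr; congr (_ *: _).
  by rewrite mulrACA sign_swap 1?eq_sym //; ring.
apply: eq_bigr => v vS; apply: eq_bigr => w; rewrite !inE negb_or.
by case/andP=> _ wS; rewrite /F vS wS.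
Qed.

Lemma eq_kd z z' S :
  (forall v, v \notin S -> z (v |: S) = z' (v |: S)) -> kd z S = kd z' S.
Proof. by move=> zz'; apply: eq_bigr => v vS; rewrite zz'. Qed.

Lemma kd_add z z' S : kd (fun T => z T + z' T) S = kd z S + kd z' S.
Proof. by rewrite -big_split; apply: eq_bigr => v _; rewrite scalerDr. Qed.

Lemma kd_opp z S : kd (fun T => - z T) S = - kd z S.
Proof. by rewrite -sumrN; apply: eq_bigr => v _; rewrite scalerN. Qed.

Lemma kd_sub z z' S : kd (fun T => z T - z' T) S = kd z S - kd z' S.
Proof. by rewrite kd_add kd_opp. Qed.

Lemma kd_scale a z S : kd (fun T => a *: z T) S = a *: kd z S.
Proof.
rewrite scaler_sumr; apply: eq_bigr => v _.
by rewrite !scalerA mulrC.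
Qed.

(** The differential is an antiderivation sending e_x to c_x.  Both the Koszul
    homotopy below and the comparison of an independence complex with its links
    come from this formula. *)
Lemma wedge_kd x z S : x \in S ->
  wedge x (kd z) S = c x *: z S - kd (wedge x z) S.
Proof.
move=> xS; rewrite /wedge {1}/kd scaler_sumr.
have xSx : x \notin S :\ x by rewrite setD11.
rewrite (bigD1 x) //= setD1K // scalerA mulrA -expr2 sqrr_sign mul1r.
congr (_ + _); rewrite -sumrN.
rewrite (eq_bigl (fun v => v \notin S)); last first.
  by move=> v; rewrite !inE; case: (eqVneq v x) => [->|]; rewrite ?xS ?andbF ?andbT.
apply: eq_bigr => v vS.
have vx : v != x by apply: contraNneq vS => ->.
have -> : (v |: S) :\ x = v |: (S :\ x).
  by apply/setP=> w; rewrite !inE; case: (eqVneq w v) => [->|] //=; rewrite vx.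
rewrite !scalerA -scaleNr; congr (_ *: _).
have vSx : v \notin S :\ x by rewrite !inE negb_and vS orbT.
have := @sign_swap x v _ vx vSx xSx; rewrite setD1K // => H.
have sq n : (-1) ^+ n * (-1) ^+ n = 1 :> R by rewrite -expr2 sqrr_sign.
have E : (-1) ^+ rank_in x (S :\ x) * (-1) ^+ rank_in v (S :\ x) =
         - ((-1) ^+ rank_in v S * (-1) ^+ rank_in x (v |: S :\ x)) :> R.
  move: H (sq (rank_in x (v |: S :\ x))) (sq (rank_in x (S :\ x))).
  move: (_ ^+ rank_in v _) (_ ^+ rank_in v _) (_ ^+ rank_in x _)
    (_ ^+ rank_in x _) => p q r s H rr ss.
  have -> : s * p = s * (p * r) * r by rewrite -!mulrA rr mulr1.
  by rewrite -[p * r]opprK -H mulrN mulNr !mulrA ss mul1r.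
by rewrite mulrA E mulNr mulrAC.
Qed.


End SignedSums.

(** * Exactness of the Koszul complex of the polynomial ring *)

Section Monomials.

Variables (K : fieldType) (N : nat).
Local Notation R := {mpoly K[N]}.
Implicit Types (S T : {set 'I_N}) (z : {set 'I_N} -> R).
Implicit Types (f g : R) (m : 'X_{1..N}) (x v : 'I_N) (P : pred 'X_{1..N}).

Definition restrict P f : R := \sum_(m <- msupp f | P m) f@_m *: 'X_[m].

Lemma mcoeff_restrict P f m : (restrict P f)@_m = if P m then f@_m else 0.
Proof.
rewrite /restrict raddf_sum /=.
under eq_bigr => m' _ do rewrite mcoeffZ mcoeffX.
have [fm|fm] := boolP (m \in msupp f); last first.
  rewrite big_seq_cond big1 => [|m' /andP[m'f _]].
    by case: ifP => // _; apply/esym/eqP; rewrite mcoeff_eq0.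
  by rewrite (_ : (m' == m) = false) ?mulr0 //; apply: contraNF fm => /eqP <-.
rewrite (big_rem m) //= eqxx mulr1 big_seq_cond big1 ?addr0 // => m' /andP[].
rewrite mem_rem_uniq ?msupp_uniq // !inE => /andP[/negbTE -> _] _.
by rewrite mulr0.
Qed.

Lemma mcoeffXM x f m :
  ('X_x * f)@_m = if (0 < m x)%N then f@_(m - U_(x))%MM else 0.
Proof.
rewrite mulrC; case: ifP => mx.
  have xm : (U_(x) <= m)%MM.
    by apply/mnm_lepP => i; rewrite mnm1E; case: eqP => // <-.
  by rewrite -{1}(submK xm) addmC mcoeffMX.
apply/eqP; rewrite mcoeff_eq0 (perm_mem (msuppMX _ _)).
apply/negP => /mapP[m' _ E]; move: mx.
by rewrite E mnmDE mnm1E eqxx.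
Qed.

(** Terms not divisible by the variable are dropped. *)
Definition divX x f : R :=
  \sum_(m <- msupp f | (0 < m x)%N) f@_m *: 'X_[m - U_(x)].

Lemma mcoeff_divX x f m : (divX x f)@_m = f@_(m + U_(x))%MM.
Proof.
rewrite /divX raddf_sum /=.
under eq_bigr => m' _ do rewrite mcoeffZ mcoeffX.
have E m' : (0 < m' x)%N -> ((m' - U_(x))%MM == m) = (m' == m + U_(x))%MM.
  move=> m'x; apply/eqP/eqP => [<-|->]; last by rewrite addmK.
  by rewrite submK //; apply/mnm_lepP => i; rewrite mnm1E; case: eqP => // <-.
under eq_bigr => m' m'x do rewrite E //.
have mx : (0 < (m + U_(x))%MM x)%N by rewrite mnmDE mnm1E eqxx addn1.
have [fm|fm] := boolP ((m + U_(x))%MM \in msupp f); last first.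
  rewrite big_seq_cond big1 => [|m' /andP[m'f _]].
    by apply/esym/eqP; rewrite mcoeff_eq0.
  rewrite (_ : (m' == _) = false) ?mulr0 //.
  by apply: contraNF fm => /eqP <-.
rewrite (big_rem (m + U_(x))%MM) //= mx eqxx mulr1 big_seq_cond big1 ?addr0 //.
move=> m' /andP[]; rewrite mem_rem_uniq ?msupp_uniq // !inE.
by case/andP=> /negbTE -> _ _; rewrite mulr0.
Qed.

Lemma divX_add x f g : divX x (f + g) = divX x f + divX x g.
Proof. by apply/mpolyP => m; rewrite mcoeffD !mcoeff_divX mcoeffD. Qed.

Lemma divX0 x : divX x 0 = 0.
Proof. by apply/mpolyP => m; rewrite mcoeff_divX !mcoeff0. Qed.

Lemma divX_opp x f : divX x (- f) = - divX x f.
Proof. by apply/mpolyP => m; rewrite mcoeff_divX !mcoeffN mcoeff_divX. Qed.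

Lemma mcoeff_signM n f m : ((-1) ^+ n * f)@_m = (-1) ^+ n * f@_m.
Proof.
by rewrite -signr_odd -[in RHS]signr_odd; case: (odd n);
  rewrite ?expr1 ?mulN1r ?mcoeffN // expr0 !mul1r.
Qed.

Lemma divX_mulX x v n f : v != x ->
  divX x ((-1) ^+ n * 'X_v * f) = (-1) ^+ n * 'X_v * divX x f.
Proof.
move=> vx; apply/mpolyP => m.
rewrite mcoeff_divX -!mulrA !mcoeff_signM !mcoeffXM; congr (_ * _).
rewrite mnmDE mnm1E eq_sym (negbTE vx) addn0 mcoeff_divX.
case: ifP => // mv; congr (f@_ _); apply/mnmP => i.
rewrite !(mnmBE, mnmDE, mnm1E).
case: (eqVneq v i) => [<-|_] /=; last by rewrite !subn0.
by rewrite eq_sym (negbTE vx) !addn0.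
Qed.

Lemma divX_sign x n f : divX x ((-1) ^+ n * f) = (-1) ^+ n * divX x f.
Proof.
by apply/mpolyP => m; rewrite mcoeff_divX !mcoeff_signM mcoeff_divX.
Qed.

Lemma divXK x f : f = 'X_x * divX x f + restrict (fun m => m x == 0)%N f.
Proof.
apply/mpolyP => m; rewrite mcoeffD mcoeffXM mcoeff_restrict mcoeff_divX.
case: posnP => mx; first by rewrite add0r.
rewrite addr0 submK //; apply/mnm_lepP => i.
by rewrite mnm1E; case: eqP => // <-.
Qed.

Lemma divX_Xmul x f : divX x ('X_x * f) = f.
Proof.
apply/mpolyP => m; rewrite mcoeff_divX mcoeffXM mnmDE mnm1E eqxx addn1 /=.
by rewrite addmK.
Qed.

Definition kdX (V : lmodType R) := @kd R V N (fun v => 'X_v).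

Definition homotopy x (z : {set 'I_N} -> R) (S : {set 'I_N}) : R :=
  if x \in S then divX x (wedge (V := R^o) x z S) else 0.

Definition retract x (z : {set 'I_N} -> R) (S : {set 'I_N}) : R :=
  if x \in S then 0 else restrict (fun m => m x == 0)%N (z S).

(** Dividing by x and multiplying by e_x is a homotopy between the identity and
    the projection to the part in which neither x nor e_x occurs. *)
Lemma homotopyP x (z : {set 'I_N} -> R) S :
  z S - retract x z S =
  kdX (V := R^o) (homotopy x z) S + homotopy x (kdX (V := R^o) z) S.
Proof.
rewrite /retract {2}/homotopy; case: ifP => xS.
  rewrite /kdX wedge_kd // subr0.
  rewrite divX_add (divX_Xmul x (z S)) addrCA divX_opp.
  rewrite [X in _ + X](_ : _ = 0) ?addr0 //.
  apply/eqP; rewrite subr_eq0; apply/eqP; rewrite /kd.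
  rewrite (big_morph _ (divX_add x) (divX0 x)); apply: eq_bigr => v vS.
  have vx : v != x by apply: contraNneq vS => ->.
  rewrite /homotopy !inE xS orbT.
  exact/esym/divX_mulX.
rewrite addr0 {1}(divXK x (z S)) addrK /kdX /kd (bigD1 x) ?xS //=.
rewrite big1 ?addr0 => [|v /andP[vS vx]]; last first.
  by rewrite /homotopy !inE xS eq_sym (negbTE vx) /= scaler0.
rewrite /homotopy setU11 /wedge.
have xnS : x \notin S by rewrite xS.
rewrite setU1K //.
rewrite /GRing.scale /= divX_sign [RHS]mulrCA -!mulrA mulrCA !mulrA.
by rewrite -expr2 sqrr_sign mul1r.
Qed.

Lemma retract_step x z i : (forall S, #|S|.+1 = i -> kdX (V := R^o) z S = 0) ->
  forall S, #|S| = i ->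
  z S = kdX (V := R^o) (homotopy x z) S + retract x z S.
Proof.
move=> cz S Si; apply/eqP; rewrite -subr_eq; apply/eqP.
rewrite homotopyP [X in _ + X](_ : _ = 0) ?addr0 // /homotopy.
case: ifP => // xS; rewrite /wedge cz ?scaler0 ?divX0 //.
by rewrite -Si [in RHS](cardsD1 x) xS.
Qed.

Lemma retract_cycle x z i : (forall S, #|S|.+1 = i -> kdX (V := R^o) z S = 0) ->
  forall S, #|S|.+1 = i -> kdX (V := R^o) (retract x z) S = 0.
Proof.
move=> cz S Si.
transitivity (kdX (V := R^o)
  (fun T => z T - kdX (V := R^o) (homotopy x z) T) S).
  apply: eq_kd => v vS; rewrite (retract_step x cz) ?cardsU1 ?vS //.
  by rewrite addrC addKr.
by rewrite /kdX kd_sub kd_kd subr0; apply: cz.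
Qed.

(** Retracting along every variable leaves nothing but the constant term in
    homological degree zero. *)
Lemma koszul_exact_poly z i :
  (forall S, #|S|.+1 = i -> kdX (V := R^o) z S = 0) ->
  (i = 0%N -> (z set0)@_0%MM = 0) ->
  exists w, forall S, #|S| = i -> z S = kdX (V := R^o) w S.
Proof.
move=> cz z0; pose zs s := foldr retract z s.
have czs s : forall S, #|S|.+1 = i -> kdX (V := R^o) (zs s) S = 0.
  by elim: s => // x s; apply: retract_cycle.
have [w Hw] : exists w, forall S, #|S| = i ->
    z S = kdX (V := R^o) w S + zs (enum 'I_N) S.
  elim: (enum 'I_N) => [|x s [w Hw]].
    exists (fun=> 0) => S _.
    by rewrite /kdX /kd big1 ?add0r // => v _; rewrite scaler0.
  exists (fun S => w S + homotopy x (zs s) S) => S Si.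
  by rewrite /kdX kd_add -addrA (Hw _ Si) {1}(retract_step x (czs s) Si).
exists w => S Si; rewrite (Hw _ Si) [X in _ + X](_ : _ = 0) ?addr0 //.
have zs0 s x : x \in s -> x \in S -> zs s S = 0.
  elim: s => //= y s IH; rewrite inE /retract => /orP[/eqP <- -> //|xs xS].
  case: ifP => // _; rewrite IH //; apply/mpolyP => m.
  by rewrite mcoeff_restrict mcoeff0 if_same.
have [S0|[x xS]] := set_0Vmem S; last by apply: zs0 xS; rewrite mem_enum.
have zsm s m x : x \in s -> (0 < m x)%N -> (zs s S)@_m = 0.
  elim: s => //= y s IH; rewrite inE /retract => /orP[/eqP <-|xs] mx.
    by case: ifP; rewrite ?mcoeff0 // mcoeff_restrict eqn0Ngt mx.
  by case: ifP; rewrite ?mcoeff0 // mcoeff_restrict IH ?if_same.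
apply/mpolyP => m; rewrite mcoeff0.
have [->|] := eqVneq m 0%MM; last first.
  move=> m0; have [x mx] : exists x, (0 < m x)%N.
    apply/existsP; apply: contraNT m0; rewrite negb_exists => /forallP H.
    by apply/eqP/mnmP => x; rewrite mnm0E; apply/eqP; have := H x; rewrite -eqn0Ngt.
  by apply: zsm mx; rewrite mem_enum.
elim: (enum 'I_N) => [|x s IH] /=.
  by rewrite S0 z0 // -Si S0 cards0.
by rewrite /retract; case: ifP; rewrite ?mcoeff0 // mcoeff_restrict mnm0E eqxx.
Qed.

Lemma kdX_row k (z : {set 'I_N} -> 'rV[R]_k) S j :
  kdX z S 0 j = kdX (V := R^o) (fun T => z T 0 j) S.
Proof. by rewrite /kdX /kd summxE; apply: eq_bigr => v _; rewrite mxE. Qed.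

Lemma koszul_exact k (z : {set 'I_N} -> 'rV[R]_k) i :
  (forall S, #|S|.+1 = i -> kdX z S = 0) ->
  (i = 0%N -> forall j, (z set0 0 j)@_0%MM = 0) ->
  exists w, forall S, #|S| = i -> z S = kdX w S.
Proof.
move=> cz z0.
have /fin_all_exists[w Hw] j : exists w, forall S, #|S| = i ->
    z S 0 j = kdX (V := R^o) w S.
  apply: koszul_exact_poly => [S Si|/z0 //].
  by rewrite -kdX_row cz ?mxE.
exists (fun S => \row_j w j S) => S Si; apply/rowP => j.
rewrite kdX_row (Hw j S Si); apply: (@eq_kd _ R^o) => v vS.
by rewrite mxE.
Qed.

End Monomials.

(** * Koszul homology of graded modules *)

Section Graded.

Variables (K : fieldType) (N : nat).
Local Notation R := {mpoly K[N]}.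
Implicit Types (f g : R) (m : 'X_{1..N}) (x v : 'I_N) (S T : {set 'I_N}).

(** The offset c collects the degree of a generator and that of a Koszul
    factor, so that no truncated subtraction e - c is needed. *)
Definition proj (c e : nat) f := restrict (fun m => mdeg m + c == e)%N f.

Lemma mcoeff_proj c e f m :
  (proj c e f)@_m = if (mdeg m + c == e)%N then f@_m else 0.
Proof. exact: mcoeff_restrict. Qed.

Lemma projD c e f g : proj c e (f + g) = proj c e f + proj c e g.
Proof.
apply/mpolyP => m; rewrite mcoeffD !mcoeff_proj mcoeffD.
by case: ifP; rewrite ?addr0.
Qed.

Lemma proj0 c e : proj c e 0 = 0.
Proof. by apply/mpolyP => m; rewrite mcoeff_proj mcoeff0 if_same. Qed.

Lemma projZ c e (a : K) f : proj c e (a *: f) = a *: proj c e f.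
Proof.
apply/mpolyP => m; rewrite mcoeffZ !mcoeff_proj mcoeffZ.
by case: ifP; rewrite ?mulr0.
Qed.

Lemma proj_sum c e (J : Type) (r : seq J) (F : J -> R) :
  proj c e (\sum_(j <- r) F j) = \sum_(j <- r) proj c e (F j).
Proof. exact: (big_morph _ (projD c e) (proj0 c e)). Qed.

Lemma proj_mulXm c c' e m f : (mdeg m + c = c')%N ->
  proj c e (f * 'X_[m]) = proj c' e f * 'X_[m].
Proof.
move=> mc; rewrite [f in LHS]mpolyE mulr_suml proj_sum.
have -> : proj c' e f =
    \sum_(m' <- msupp f) proj c' e (f@_m' *: 'X_[m']).
  by rewrite [f in LHS]mpolyE proj_sum.
rewrite mulr_suml; apply: eq_bigr => m' _.
rewrite -scalerAl !projZ -scalerAl; congr (_ *: _).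
rewrite -mpolyXD; apply/mpolyP => m1.
have E : proj c' e 'X_[m'] = if (mdeg m' + c' == e)%N then 'X_[m'] else 0 :> R.
  apply/mpolyP => m2; rewrite mcoeff_proj mcoeffX.
  case: (eqVneq m' m2) => [<-|m2m].
    by case: ifP; rewrite ?mcoeff0 // mcoeffX eqxx.
  rewrite if_same; case: ifP; rewrite ?mcoeff0 // mcoeffX.
  by rewrite (negbTE m2m).
rewrite E mcoeff_proj mcoeffX -mc.
case: (eqVneq (m' + m)%MM m1) => [<-|ne].
  rewrite mdegD addnA; case: ifP => _; last by rewrite mul0r mcoeff0.
  by rewrite -mpolyXD mcoeffX eqxx.
rewrite if_same; case: ifP => _; last by rewrite mul0r mcoeff0.
by rewrite -mpolyXD mcoeffX (negbTE ne).
Qed.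

Lemma proj_mul c c' e f g : (forall m, m \in msupp g -> mdeg m + c = c')%N ->
  proj c e (f * g) = proj c' e f * g.
Proof.
move=> hg; rewrite [g]mpolyE !mulr_sumr proj_sum !big_seq.
apply: eq_bigr => m mg.
by rewrite -!scalerAr projZ (proj_mulXm _ _ (hg _ mg)).
Qed.

(** The part of degree e of a row over generators of degrees a, seen as the
    coefficient of a Koszul generator of degree s. *)
Definition pr k (a : 'I_k -> nat) (s e : nat) (u : 'rV[R]_k) : 'rV[R]_k :=
  \row_j proj (a j + s) e (u 0 j).

Section Rows.

Variables (k : nat) (a : 'I_k -> nat).
Implicit Types (u t : 'rV[R]_k) (z y w : {set 'I_N} -> 'rV[R]_k)
  (L M : 'rV[R]_k -> Prop).

Lemma prD s e u t : pr a s e (u + t) = pr a s e u + pr a s e t.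
Proof. by apply/rowP => j; rewrite !mxE projD. Qed.

Lemma pr0 s e : pr a s e 0 = 0.
Proof. by apply/rowP => j; rewrite !mxE proj0. Qed.

Lemma prN s e u : pr a s e (- u) = - pr a s e u.
Proof. by apply/eqP; rewrite -addr_eq0 -prD addNr pr0. Qed.

Lemma prB s e u t : pr a s e (u - t) = pr a s e u - pr a s e t.
Proof. by rewrite prD prN. Qed.

Lemma pr_sum s e (J : Type) (r : seq J) (P : pred J) (F : J -> 'rV[R]_k) :
  pr a s e (\sum_(j <- r | P j) F j) = \sum_(j <- r | P j) pr a s e (F j).
Proof. exact: (big_morph _ (prD s e) (pr0 s e)). Qed.

Lemma pr_pr s e u : pr a s e (pr a s e u) = pr a s e u.
Proof.
apply/rowP => j; rewrite !mxE; apply/mpolyP => m; rewrite !mcoeff_proj.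
by case: (_ == _).
Qed.

Lemma prX s e x u : pr a s e ('X_x *: u) = 'X_x *: pr a s.+1 e u.
Proof.
apply/rowP => j; rewrite !mxE mulrC [RHS]mulrC; apply: proj_mul => m.
by rewrite msuppX inE => /eqP ->; rewrite mdeg1 add1n addnS.
Qed.

Lemma pr_sign s e n u : pr a s e ((-1) ^+ n *: u) = (-1) ^+ n *: pr a s e u.
Proof.
by rewrite -signr_odd; case: (odd n);
  rewrite ?expr1 ?expr0 ?scaleN1r ?prN ?scale1r.
Qed.

Lemma prS s e u : pr a s.+1 e.+1 u = pr a s e u.
Proof.
by apply/rowP => j; rewrite !mxE; apply/mpolyP => m;
  rewrite !mcoeff_proj !addnS eqSS.
Qed.

Lemma pr_small s e u : (e < s)%N -> pr a s e u = 0.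
Proof.
move=> es; apply/rowP => j; rewrite !mxE; apply/mpolyP => m.
rewrite mcoeff_proj mcoeff0; case: eqP => // E; lia.
Qed.

Definition prz e z S := pr a #|S| e (z S).

Lemma pr_kd e z S : pr a #|S| e (kdX z S) = kdX (prz e z) S.
Proof.
rewrite /kdX /kd pr_sum; apply: eq_bigr => v vS.
by rewrite -!scalerA pr_sign prX /prz cardsU1 vS add1n.
Qed.

Lemma prz_sum u : exists B, u = \sum_(e < B) pr a 0 e u.
Proof.
have [B HB] : exists B, forall j m, m \in msupp (u 0 j) -> (mdeg m + a j < B)%N.
  have /fin_all_exists[b hb] j : exists b, forall m, m \in msupp (u 0 j) ->
      (mdeg m + a j < b)%N.
    exists (\max_(m <- msupp (u 0 j)) (mdeg m + a j)).+1 => m mu.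
    rewrite ltnS; exact: (@leq_bigmax_seq _ (msupp (u 0 j)) xpredT (fun m => mdeg m + a j)%N).
  exists (\max_j b j) => j m mu; apply: leq_trans (hb j m mu) _.
  exact: leq_bigmax.
exists B; apply/rowP => j; rewrite summxE; apply/mpolyP => m.
rewrite raddf_sum /=.
under eq_bigr => e _ do rewrite mxE mcoeff_proj addn0.
have [mu|mu] := boolP (m \in msupp (u 0 j)).
  rewrite (bigD1 (Ordinal (HB j m mu))) //= eqxx big1 ?addr0 // => e.
  by rewrite -val_eqE /= eq_sym => /negbTE ->.
have -> : (u 0 j)@_m = 0 by apply/eqP; rewrite mcoeff_eq0.
by rewrite big1 // => e _; rewrite if_same.
Qed.

Definition graded_submod L : Prop :=
  [/\ L 0, forall u t, L u -> L t -> L (u + t),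
      forall f u, L u -> L (f *: u)
    & forall s e u, L u -> L (pr a s e u)].

Section Submod.
Variable L : 'rV[R]_k -> Prop.
Hypothesis sL : graded_submod L.

Lemma sub0 : L 0. Proof. by case: sL. Qed.
Lemma subD u t : L u -> L t -> L (u + t). Proof. by case: sL => _ + _ _; apply. Qed.
Lemma subZ f u : L u -> L (f *: u). Proof. by case: sL => _ _ + _; apply. Qed.
Lemma sub_pr s e u : L u -> L (pr a s e u). Proof. by case: sL => _ _ _; apply. Qed.
Lemma subN u : L u -> L (- u).
Proof. by rewrite -scaleN1r; apply: subZ. Qed.
Lemma subB u t : L u -> L t -> L (u - t).
Proof. by move=> Lu Lt; apply: subD => //; apply: subN. Qed.
Lemma sub_sum (J : Type) (r : seq J) (P : pred J) (F : J -> 'rV[R]_k) :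
  (forall j, P j -> L (F j)) -> L (\sum_(j <- r | P j) F j).
Proof. exact: (big_ind L sub0 subD). Qed.
Lemma sub_kd z S : (forall v, v \notin S -> L (z (v |: S))) -> L (kdX z S).
Proof. by move=> Lz; apply: sub_sum => v vS; apply: subZ; apply: Lz. Qed.

End Submod.

(** The Koszul homology of the quotient by L vanishes in homological degree i
    and internal degree e.  Cycles are arbitrary and their part of degree e is
    taken, which spares carrying homogeneity through every diagram chase. *)
Definition quotient_exact L i e : Prop :=
  forall z, (forall S, #|S|.+1 = i -> L (kdX z S)) ->
  exists w, forall S, #|S| = i -> L (prz e z S - kdX w S).

Definition submod_exact M i e : Prop :=
  forall z, (forall S, #|S| = i -> M (z S)) ->
  (forall S, #|S|.+1 = i -> kdX z S = 0) ->
  exists w, (forall S, #|S| = i.+1 -> M (w S)) /\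
    (forall S, #|S| = i -> prz e z S = kdX w S).

Lemma card_U1 v S : v \notin S -> #|v |: S| = #|S|.+1.
Proof. by move=> vS; rewrite cardsU1 vS. Qed.

(** A cycle of R/L is a boundary of R/(L, x) up to a multiple x y, and then y is
    a cycle of R/(L : x): this is the exactness in the middle of the sequence
    of R/(L : x)(-1), R/L and R/(L, x). *)
Lemma quotient_exact_branch L x i e : graded_submod L ->
  (forall e', e = e'.+1 -> quotient_exact (fun u => L ('X_x *: u)) i e') ->
  quotient_exact (fun u => exists t, L (u - 'X_x *: t)) i e ->
  quotient_exact L i e.
Proof.
move=> sL Hcolon Hsum z cz.
have [w Hw] : exists w, forall S, #|S| = i ->
    exists t, L (prz e z S - kdX w S - 'X_x *: t).
  by apply: Hsum => S Si; exists 0; rewrite scaler0 subr0; apply: cz.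
have {Hw}/fin_all_exists[y Hy] S : exists t, #|S| = i ->
    L (prz e z S - kdX w S - 'X_x *: t).
  have [/Hw[y]|ne] := eqVneq #|S| i; first by exists y.
  by exists 0 => /eqP; rewrite (negbTE ne).
have cy S : #|S|.+1 = i -> L ('X_x *: kdX y S).
  move=> Si; rewrite -[X in L X]opprK; apply: subN => //.
  have -> : - ('X_x *: kdX y S) =
     kdX (fun T => prz e z T - kdX w T - 'X_x *: y T) S - kdX (prz e z) S.
    rewrite /kdX [in RHS]kd_sub kd_scale kd_sub kd_kd subr0.
    by rewrite addrAC subrr add0r.
  apply: subB => //; last by rewrite -pr_kd; apply: sub_pr => //; apply: cz.
  by apply: sub_kd => // v vS; apply: Hy; rewrite card_U1.
have [w' Hw'] : exists w', forall S, #|S| = i ->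
    L ('X_x *: (pr a #|S|.+1 e (y S) - kdX w' S)).
  case: e Hcolon {Hsum w Hy} => [_|e Hcolon].
    exists (fun=> 0) => S _; rewrite pr_small // /kdX /kd big1 ?subr0 ?scaler0.
      exact: sub0.
    by move=> v _; rewrite scaler0.
  have [w' Hw'] := Hcolon e erefl y cy.
  by exists w' => S Si; rewrite prS; apply: Hw'.
exists (fun S => prz e w S + 'X_x *: w' S) => S Si.
rewrite /kdX kd_add kd_scale -[kd _ (prz e w) S]pr_kd.
have := subD sL (sub_pr sL #|S| e (Hy S Si)) (Hw' S Si).
rewrite !prB {1}/prz pr_pr prX scalerBr; congr L.
by rewrite addrA subrK opprD addrA.
Qed.

(** Multiplication by a nonzerodivisor x embeds R/L(-1) in R/L with cokernel
    R/(L, x), so the homology of the latter sits between those of R/L in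
    degrees i and i - 1. *)
Lemma quotient_exact_regular L x i e : graded_submod L ->
  (forall u, L ('X_x *: u) -> L u) ->
  (forall i' e', i = i'.+1 -> e = e'.+1 -> quotient_exact L i' e') ->
  quotient_exact L i e ->
  quotient_exact (fun u => exists t, L (u - 'X_x *: t)) i e.
Proof.
move=> sL reg Hprev Hi z cz.
case: i cz Hprev Hi => [|i] cz Hprev Hi.
  have [w Hw] := Hi z (fun S (H : #|S|.+1 = 0%N) => ltac:(discriminate)).
  by exists w => S Si; exists 0; rewrite scaler0 subr0; apply: Hw.
have /fin_all_exists[y Hy] S : exists t, #|S| = i ->
    L (kdX z S - 'X_x *: t).
  have [Si|ne] := eqVneq #|S| i; last by exists 0 => /eqP; rewrite (negbTE ne).
  by have [|t Ht] := cz S; [rewrite Si | exists t].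
have cy S : #|S|.+1 = i -> L (kdX y S).
  move=> Si; apply: reg; rewrite -[X in L X]opprK; apply: subN => //.
  have -> : - ('X_x *: kdX y S) = kdX (fun T => kdX z T - 'X_x *: y T) S.
    by rewrite /kdX kd_sub kd_scale kd_kd sub0r.
  by apply: sub_kd => // v vS; apply: Hy; rewrite card_U1.
have [w' Hw'] : exists w', forall S, #|S| = i ->
    L ('X_x *: (pr a #|S|.+1 e (y S) - kdX w' S)).
  case: e Hprev {Hi} => [_|e Hprev].
    exists (fun=> 0) => S _; rewrite pr_small // /kdX /kd big1 ?subr0 ?scaler0.
      exact: sub0.
    by move=> v _; rewrite scaler0.
  have [w' Hw'] := Hprev i e erefl erefl y cy.
  by exists w' => S Si; rewrite prS; apply: subZ => //; apply: Hw'.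
have [|w Hw] := Hi (fun S => prz e z S - 'X_x *: w' S).
  move=> S [Si]; rewrite /kdX kd_sub kd_scale -[kd _ (prz e z) S]pr_kd.
  have := subD sL (sub_pr sL #|S| e (Hy S Si)) (Hw' S Si).
  by rewrite prB prX scalerBr addrA subrK.
exists w => S Si; exists (pr a #|S|.+1 e (w' S)).
have := Hw S Si; rewrite {1}/prz prB pr_pr prX.
by rewrite addrAC.
Qed.

Lemma quotient_exact_ext L L' i e : (forall u, L u <-> L' u) ->
  quotient_exact L i e -> quotient_exact L' i e.
Proof.
move=> LL' H z cz; have [|w Hw] := H z; first by move=> S /cz /LL'.
by exists w => S /Hw /LL'.
Qed.

End Rows.
End Graded.

(** * Dimension shift along a presentation *)

Lemma guarded_choice (I : finType) (T : Type) (Q : pred I) (P : I -> T -> Prop)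
  (t0 : T) : (forall i, Q i -> exists t, P i t) ->
  exists f, forall i, Q i -> P i (f i).
Proof.
move=> H; apply: (fin_all_exists (P := fun i t => Q i -> P i t)) => i.
by case: (boolP (Q i)) => [/H[t Ht]|_]; [exists t | exists t0].
Qed.

Section Shift.

Variables (K : fieldType) (N : nat).
Local Notation R := {mpoly K[N]}.
Implicit Types (S T : {set 'I_N}).

Definition graded_mx k l (a : 'I_k -> nat) (b : 'I_l -> nat) (D : 'M[R]_(l, k)) :=
  forall i j m, m \in msupp (D i j) -> (mdeg m + a j)%N = b i.

Lemma kd_mulmx k l (D : 'M[R]_(l, k)) (z : {set 'I_N} -> 'rV[R]_l) S :
  kdX (fun T => z T *m D) S = kdX z S *m D.
Proof.
by rewrite /kdX /kd mulmx_suml; apply: eq_bigr => v _; rewrite scalemxAl.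
Qed.

Lemma pr_mulmx k l a b (D : 'M[R]_(l, k)) s e (u : 'rV[R]_l) :
  graded_mx a b D -> pr a s e (u *m D) = pr b s e u *m D.
Proof.
move=> gD; apply/rowP => j; rewrite !mxE proj_sum; apply: eq_bigr => i _.
by rewrite mxE; apply: proj_mul => m /gD <-; rewrite addnA.
Qed.

Lemma ker_graded k l a b (D : 'M[R]_(l, k)) :
  graded_mx a b D -> graded_submod b (fun u => u *m D = 0).
Proof.
move=> gD; split=> [|u t uD tD|f u uD|s e u uD]; first by rewrite mul0mx.
- by rewrite mulmxDl uD tD addr0.
- by rewrite -scalemxAl uD scaler0.
by rewrite -(pr_mulmx _ _ _ gD) uD pr0.
Qed.

Section OneStep.

Variables (k l : nat) (a : 'I_k -> nat) (b : 'I_l -> nat) (D : 'M[R]_(l, k)).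
Variable M : 'rV[R]_k -> Prop.
Hypothesis gD : graded_mx a b D.
Hypothesis imD : forall u, M u <-> exists v, u = v *m D.
Hypothesis minD : forall u : 'rV_l, u *m D = 0 -> forall j, (u 0 j)@_0%MM = 0.

(** The kernel of a minimal presentation has the Koszul homology of the
    presented module, shifted by one, because the free module in the middle
    has homology in degree zero only and minimality kills the map it induces
    there. *)
Lemma submod_exact_shift i e :
  submod_exact b (fun u => u *m D = 0) i e <-> submod_exact a M i.+1 e.
Proof.
split=> H z zM cz.
  have [y Hy] : exists y : {set 'I_N} -> 'rV[R]_l, forall S, #|S| == i.+1 ->
      z S = y S *m D.
    apply: (guarded_choice (P := fun S t => z S = t *m D) 0).
    by move=> S /eqP /zM /imD.
  have [S Si|S Si|w [wD Hw]] := H (kdX y).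
  - rewrite -kd_mulmx -(cz S) ?Si //; apply: eq_kd => v vS.
    by rewrite -Hy // card_U1 // Si.
  - exact: kd_kd.
  have [S [Si]||t Ht] := @koszul_exact _ _ _ (fun S => prz b e y S - w S) i.+1.
  - by rewrite /kdX kd_sub -[kd _ (prz b e y) S]pr_kd [pr _ _ _ _]Hw // subrr.
  - by [].
  exists (fun S => t S *m D); split=> S Si; first by apply/imD; exists (t S).
  rewrite kd_mulmx -Ht // mulmxBl wD // subr0 /prz.
  by rewrite -(pr_mulmx _ _ _ gD) -Hy ?Si.
have [y Hy] : exists y, forall S, #|S| = i -> z S = kdX y S.
  apply: koszul_exact => // i0 j; apply: minD.
  by rewrite zM // cards0 i0.
have [S Si|S [Si]|w [wM Hw]] := H (fun S => y S *m D).
- by apply/imD; exists (y S).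
- by rewrite kd_mulmx -Hy // zM.
have [y' Hy'] : exists y' : {set 'I_N} -> 'rV[R]_l, forall S, #|S| == i.+2 ->
    w S = y' S *m D.
  apply: (guarded_choice (P := fun S t => w S = t *m D) 0).
  by move=> S /eqP /wM /imD.
exists (fun S => prz b e y S - kdX y' S); split=> S Si.
  rewrite mulmxBl /prz -(pr_mulmx _ _ _ gD) -kd_mulmx.
  have := Hw S Si; rewrite /prz => ->; apply/eqP; rewrite subr_eq0; apply/eqP.
  by apply: eq_kd => v vS; rewrite Hy' // card_U1 // Si.
by rewrite /kdX kd_sub kd_kd subr0 -[kd _ (prz b e y) S]pr_kd -Hy.
Qed.

End OneStep.

(** The same shift for the quotient of a free module by a submodule without
    constant terms. *)
Lemma quotient_exact_shift k (a : 'I_k -> nat) (L : 'rV[R]_k -> Prop) i e :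
  (forall u, L u -> forall j, (u 0 j)@_0%MM = 0) ->
  quotient_exact a L i.+1 e <-> submod_exact a L i e.
Proof.
move=> Lm; split=> H z.
  move=> zL cz.
  have [y Hy] : exists y, forall S, #|S| = i -> z S = kdX y S.
    by apply: koszul_exact => // i0 j; apply: Lm; apply: zL; rewrite cards0 i0.
  have [|w Hw] := H y; first by move=> S [Si]; rewrite -Hy //; apply: zL.
  exists (fun S => prz a e y S - kdX w S); split=> // S Si.
  by rewrite /kdX kd_sub kd_kd subr0 -[kd _ (prz a e y) S]pr_kd -Hy.
move=> cz; have [S Si|S Si|w [wL Hw]] := H (kdX z).
- by apply: cz; rewrite Si.
- exact: kd_kd.
have [S [Si]||t Ht] := @koszul_exact _ _ _ (fun S => prz a e z S - w S) i.+1.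
- by rewrite /kdX kd_sub -[kd _ (prz a e z) S]pr_kd [pr _ _ _ _]Hw // subrr.
- by [].
by exists t => S Si; rewrite -Ht // opprB addrC subrK; apply: wL.
Qed.

(** * Minimal systems of generators *)

(** A boundary in homological degree zero is a combination of the variables,
    so where the homology vanishes M is generated by its elements of smaller
    degree. *)
Lemma nakayama k (a : 'I_k -> nat) (M P : 'rV[R]_k -> Prop) E :
  graded_submod a M ->
  P 0 -> (forall u t, P u -> P t -> P (u + t)) -> (forall f u, P u -> P (f *: u)) ->
  (forall e, (E <= e)%N -> submod_exact a M 0 e) ->
  (forall e u, (e < E)%N -> M u -> P (pr a 0 e u)) ->
  forall u, M u -> P u.
Proof.
move=> sM P0 PD PZ ex Psmall u Mu.
have pk e (w : {set 'I_N} -> 'rV[R]_k) :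
    pr a 0 e (kdX w set0) = kdX (prz a e w) set0.
  by have := pr_kd a e w set0; rewrite cards0.
have H e : forall t, M t -> P (pr a 0 e t).
  elim: e => [|e IH] t Mt.
    case: (posnP E) => E0; last exact: Psmall.
    have [|||w [_ Hw]] := ex 0%N _ (fun=> t); rewrite ?E0 //.
    have := Hw set0 (cards0 _); rewrite /prz cards0 => Hw0.
    rewrite -pr_pr Hw0 pk /kdX /kd big1 // => v vS.
    by rewrite /prz card_U1 // pr_small ?scaler0 // cards0.
  case: (ltnP e.+1 E) => eE; first exact: Psmall.
  have [//|//|w [Mw Hw]] := ex e.+1 eE (fun=> t).
  have := Hw set0 (cards0 _); rewrite /prz cards0 => Hw0.
  rewrite -pr_pr Hw0 pk /kdX /kd.
  apply: (big_ind P) => // v vS; apply: PZ.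
  rewrite /prz card_U1 // cards0 prS; apply: IH; apply: Mw.
  by rewrite card_U1 // cards0.
have [B ->] := prz_sum a u.
by apply: (big_ind P) => // e _; apply: H.
Qed.

Fixpoint kspan k (ts : seq 'rV[R]_k) (u : 'rV[R]_k) : Prop :=
  if ts is t :: ts' then exists c : K, kspan ts' (u - c%:MP *: t) else u = 0.

Lemma kspan0 k (ts : seq 'rV[R]_k) : kspan ts 0.
Proof.
by elim: ts => //= t ts IH; exists 0; rewrite mpolyC0 scale0r subr0.
Qed.

Lemma kspanD k (ts : seq 'rV[R]_k) c u t :
  kspan ts u -> kspan ts t -> kspan ts (u + c%:MP *: t).
Proof.
elim: ts u t => /= [u t -> ->|x ts IH u t [c1 H1] [c2 H2]].
  by rewrite scaler0 addr0.
exists (c1 + c * c2); have := IH _ _ H1 H2.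
rewrite mpolyCD mpolyCM scalerDl scalerBr scalerA => H.
by congr (kspan ts _): H; rewrite addrACA -opprD.
Qed.

Lemma kspan_mem k (ts : seq 'rV[R]_k) u : u \in ts -> kspan ts u.
Proof.
elim: ts => //= t ts IH; rewrite inE => /orP[/eqP ->|/IH H].
  by exists 1; rewrite mpolyC1 scale1r subrr; apply: kspan0.
by exists 0; rewrite mpolyC0 scale0r subr0.
Qed.

(** Elimination along the spanning list: an element of U involving the first
    vector serves to remove that vector from all others. *)
Lemma subspace_fg k (ts : seq 'rV[R]_k) (U : 'rV[R]_k -> Prop) :
  (forall u t c, U u -> U t -> U (u + c%:MP *: t)) ->
  (forall u, U u -> kspan ts u) ->
  exists2 us : seq 'rV[R]_k, (forall u, u \in us -> U u) &
    forall P : 'rV[R]_k -> Prop, P 0 ->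
      (forall u t c, P u -> P t -> P (u + c%:MP *: t)) ->
      (forall u, u \in us -> P u) -> forall u, U u -> P u.
Proof.
elim: ts U => [|t ts IH] U UD Uts.
  by exists [::] => // P P0 _ _ u /Uts /= ->.
have [[u0 [c0 [Uu0 c0n0 H0]]]|none] := classic (exists u0 c0,
    [/\ U u0, c0 != 0 & kspan ts (u0 - c0%:MP *: t)]); last first.
  apply: IH => // u Uu; have [c Hc] := Uts u Uu.
  have [c0|cn0] := eqVneq c 0.
    by move: Hc; rewrite c0 mpolyC0 scale0r subr0.
  by case: none; exists u, c.
have [||us usU Hus] := IH (fun u => U u /\ kspan ts u).
- by move=> u v c [Uu Hu] [Uv Hv]; split; [apply: UD | apply: kspanD].
- by move=> u [].
exists (u0 :: us).
  by move=> u; rewrite inE => /orP[/eqP -> //|/usU []].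
move=> P P0 PD Pus u Uu.
have [c Hc] := Uts u Uu.
have H1 : kspan ts (u + (- (c / c0))%:MP *: u0).
  have := kspanD (- (c / c0)) Hc H0; congr (kspan ts _).
  have E : - (c / c0) * c0 = - c by rewrite mulNr divfK.
  rewrite scalerBr scalerA -mpolyCM E (mpolyCN _ c) scaleNr opprK addrACA.
  by rewrite addNr addr0.
have Pu : P (u + (- (c / c0))%:MP *: u0).
  apply: Hus => //; last by split=> //; apply: UD.
  by move=> v vus; apply: Pus; rewrite inE vus orbT.
have := PD _ _ (c / c0) Pu (Pus u0 (mem_head _ _)); congr P.
by rewrite -addrA -scalerDl -mpolyCD addNr mpolyC0 scale0r addr0.
Qed.

End Shift.

Section Generators.

Variables (K : fieldType) (N : nat).
Local Notation R := {mpoly K[N]}.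

Lemma pr_homogeneous k (a : 'I_k -> nat) d (u : 'rV[R]_k) j m :
  pr a 0 d u = u -> m \in msupp (u 0 j) -> (mdeg m + a j)%N = d.
Proof.
move=> <-; rewrite mxE mcoeff_msupp mcoeff_proj addn0.
by case: ifP => [/eqP //|_]; rewrite eqxx.
Qed.

Definition monomial_rows k e : seq 'rV[R]_k :=
  [seq 'X_[bmnm m] *: delta_mx 0 j | m <- enum {: 'X_{1..N < e.+1}}, j <- enum 'I_k].

Lemma kspan_monomial_rows k (a : 'I_k -> nat) e u :
  pr a 0 e u = u -> kspan (monomial_rows k e) u.
Proof.
move=> hu; set ts := monomial_rows k e.
have kD u1 u2 : kspan ts u1 -> kspan ts u2 -> kspan ts (u1 + u2).
  by move=> H1 H2; have := kspanD 1 H1 H2; rewrite mpolyC1 scale1r.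
rewrite [u]row_sum_delta.
apply: (big_ind (kspan ts)) => [||j _]; [exact: kspan0 | exact: kD |].
rewrite [u 0 j]mpolyE scaler_suml big_seq.
apply: (big_ind (kspan ts)) => [||m mu]; [exact: kspan0 | exact: kD |].
have me : (mdeg m < e.+1)%N by rewrite ltnS -(pr_homogeneous hu mu) leq_addr.
rewrite -mul_mpolyC -scalerA -[X in kspan ts X]add0r.
apply: kspanD; first exact: kspan0.
apply: kspan_mem; apply/allpairsP; exists (BMultinom me, j).
by split; rewrite ?mem_enum.
Qed.

Section FiniteGeneration.

Variables (k : nat) (a : 'I_k -> nat) (M : 'rV[R]_k -> Prop).
Hypothesis sM : graded_submod a M.

Lemma low_degree_generators E : exists2 gs : seq ('rV[R]_k * nat),
  forall g, g \in gs -> M g.1 /\ pr a 0 g.2 g.1 = g.1 &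
  forall P : 'rV[R]_k -> Prop, P 0 -> (forall u t, P u -> P t -> P (u + t)) ->
    (forall f u, P u -> P (f *: u)) -> (forall g, g \in gs -> P g.1) ->
    forall e u, (e < E)%N -> M u -> P (pr a 0 e u).
Proof.
elim: E => [|E [gs gsM Hgs]]; first by exists [::].
have [|u [_ /kspan_monomial_rows //]|us usM Hus] := @subspace_fg K N k
    (monomial_rows k E) (fun u => M u /\ pr a 0 E u = u).
  move=> u t c [Mu hu] [Mt ht]; split; first exact/(subD sM Mu)/(subZ sM).
  rewrite prD hu; congr (_ + _); rewrite -[in RHS]ht.
  by apply/rowP => j; rewrite !mxE !mul_mpolyC projZ.
exists (gs ++ [seq (u, E) | u <- us]).
  by move=> g; rewrite mem_cat => /orP[/gsM //|/mapP[u /usM uM ->]].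
move=> P P0 PD PZ Pg e u; rewrite ltnS leq_eqVlt => /orP[/eqP -> | eE] Mu.
  apply: Hus => //; last by split; [apply: sub_pr | apply: pr_pr].
    by move=> v t c Pv Pt; apply: PD => //; apply: PZ.
  move=> v vus; apply: (Pg (v, E)); rewrite mem_cat; apply/orP; right.
  by apply/mapP; exists v.
apply: Hgs => // g ggs; apply: Pg.
by rewrite mem_cat ggs.
Qed.

Definition presents l (b : 'I_l -> nat) (D : 'M[R]_(l, k)) :=
  graded_mx a b D /\ forall u, M u <-> exists v, u = v *m D.

Lemma finite_presentation E :
  (forall e, (E <= e)%N -> submod_exact a M 0 e) ->
  exists l (b : 'I_l -> nat) D, presents b D.
Proof.
move=> ex; have [gs gsM Hgs] := low_degree_generators E.
pose g (i : 'I_(size gs)) := tnth (in_tuple gs) i.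
have gM i : M (g i).1 /\ pr a 0 (g i).2 (g i).1 = (g i).1.
  by apply: gsM; rewrite /g mem_tnth.
pose D := \matrix_(i < size gs, j < k) (g i).1 0 j.
exists (size gs), (fun i => (g i).2), D; split.
  move=> i j m; rewrite mxE => mg.
  by have [_ /pr_homogeneous] := gM i; apply.
have DE v : v *m D = \sum_i v 0 i *: (g i).1.
  by rewrite mulmx_sum_row; apply: eq_bigr => i _; congr (_ *: _);
     apply/rowP => j; rewrite !mxE.
split; last first.
  by case=> v ->; rewrite DE; apply: (sub_sum sM) => i _; apply: (subZ sM); case: (gM i).
pose Q (u : 'rV[R]_k) := exists v : 'rV_(size gs), u = v *m D.
have P0 : Q 0 by exists 0; rewrite mul0mx.
have PD x y : Q x -> Q y -> Q (x + y).
  by case=> v -> [w ->]; exists (v + w); rewrite mulmxDl.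
have PZ f x : Q x -> Q (f *: x).
  by case=> v ->; exists (f *: v); rewrite scalemxAl.
move: u; apply: (nakayama sM P0 PD PZ ex) => e t eE Mt.
apply: (Hgs _ P0 PD PZ _ e t eE Mt) => h hgs.
have [i ->] : exists i, h = g i.
  by have /tnthP[i ->] : h \in in_tuple gs by []; exists i.
exists (delta_mx 0 i); rewrite -rowE; apply/rowP => j; by rewrite !mxE.
Qed.

(** A generator whose coefficient in a relation has a nonzero constant term is
    redundant: the homogeneous part of the relation of the right degree solves
    for it. *)
Lemma drop_generator l (b : 'I_l.+1 -> nat) (D : 'M[R]_(l.+1, k)) (u : 'rV[R]_l.+1) j0 :
  presents b D -> u *m D = 0 -> (u 0 j0)@_0%MM != 0 ->
  exists (b' : 'I_l -> nat) (D' : 'M_(l, k)), presents b' D'.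
Proof.
move=> [gD imD] uD0 c0; set c := (_@_0%MM) in c0.
have [u' [u'D u'j]] : exists u' : 'rV[R]_l.+1, u' *m D = 0 /\ u' 0 j0 = c%:MP.
  exists (pr b 0 (b j0) u); split; first by rewrite -(pr_mulmx _ _ _ gD) uD0 pr0.
  rewrite mxE; apply/mpolyP => m; rewrite mcoeff_proj mcoeffC addn0.
  rewrite -[X in _ == X]add0n eqn_add2r mdeg_eq0 mulrC.
  by case: eqP => [->|_]; rewrite ?mul1r ?mul0r.
exists (b \o lift j0), (row' j0 D); split.
  by move=> i j m; rewrite mxE => /gD.
have E (v : 'rV_l.+1) : v 0 j0 = 0 -> v *m D = col' j0 v *m row' j0 D.
  move=> v0; apply/rowP => q; rewrite !mxE (bigD1_ord j0) //= v0 mul0r add0r.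
  by apply: eq_bigr => i _; rewrite !mxE.
move=> t; rewrite imD; split=> [[v ->]|[v ->]].
  exists (col' j0 (v - (v 0 j0 * (c^-1)%:MP) *: u')); rewrite -E.
    by rewrite mulmxBl -scalemxAl u'D scaler0 subr0.
  by rewrite !mxE u'j -mulrA -mpolyCM mulVf // mulr1 subrr.
exists (\row_i if unlift j0 i is Some i' then v 0 i' else 0).
rewrite E; last by rewrite mxE unlift_none.
congr (_ *m _); apply/rowP => i; by rewrite !mxE liftK.
Qed.

Lemma nat_min (P : nat -> Prop) :
  (exists n, P n) -> exists n, P n /\ forall m, P m -> (n <= m)%N.
Proof.
case=> n; elim/ltn_ind: n => n IH Pn.
have [[m [Pm mn]]|none] := classic (exists m, P m /\ (m < n)%N).
  exact: IH Pm.
exists n; split=> // m Pm; rewrite leqNgt; apply/negP => mn.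
by apply: none; exists m.
Qed.

(** The least number of generators is taken, instead of a basis of M/mM. *)
Lemma minimal_presentation E :
  (forall e, (E <= e)%N -> submod_exact a M 0 e) ->
  exists l (b : 'I_l -> nat) D, [/\ presents b D,
    forall u : 'rV_l, u *m D = 0 -> forall j, (u 0 j)@_0%MM = 0
    & (forall e, submod_exact a M 0 e) -> l = 0%N].
Proof.
move=> /finite_presentation/nat_min[l [[b [D bD]] lmin]].
have minD (u : 'rV_l) : u *m D = 0 -> forall j, (u 0 j)@_0%MM = 0.
  move=> uD j; apply/eqP/contraT => uj.
  case: l b D bD lmin u uD j uj => [|l] b D bD lmin u uD j uj; first by case: j uj.
  have [b' [D' bD']] := drop_generator bD uD uj.
  by have := lmin l; rewrite ltnn; apply; exists b', D'.
exists l, b, D; split=> // ex.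
apply/eqP; case: (posnP l) => [//|lpos].
have M0 u : M u -> u = 0.
  move: u; apply: (nakayama (P := fun u => u = 0) (E := 0%N) sM) => //.
    by move=> x y -> ->; rewrite addr0.
    by move=> f t ->; rewrite scaler0.
have j : 'I_l by exact: (Ordinal lpos).
have [_ imD] := bD.
have := minD (delta_mx 0 j) _ j; rewrite mxE !eqxx mcoeff1 eqxx => H.
have /eqP := H (M0 _ (proj2 (imD _) (ex_intro _ _ erefl))).
by rewrite oner_eq0.
Qed.

End FiniteGeneration.

End Generators.

(** * The minimal graded free resolution *)

Section Resolution.

Variables (K : fieldType) (N : nat).
Local Notation R := {mpoly K[N]}.

(** A syzygy module in the free module that contains it: what one step of the
    construction hands to the next. *)
Record stage := Stage {
  srk : nat;
  sdeg : 'I_srk -> nat;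
  ssub : 'rV[R]_srk -> Prop }.

Definition stage_exact s i e := submod_exact (@sdeg s) (@ssub s) i e.

Definition good E s :=
  graded_submod (@sdeg s) (@ssub s) /\
  forall i e, (E <= e)%N -> stage_exact s i e.

Definition step s s' (D : 'M[R]_(srk s', srk s)) :=
  [/\ presents (@sdeg s) (@ssub s) (@sdeg s') D,
      forall u, ssub u <-> u *m D = 0,
      forall u : 'rV_(srk s'), ssub u -> forall j, (u 0 j)@_0%MM = 0,
      forall i e, stage_exact s' i e <-> stage_exact s i.+1 e
    & srk s' = 0%N <-> forall e, stage_exact s 0 e].

Lemma next_stage E s : good E s ->
  exists s' (D : 'M_(srk s', srk s)), step D /\ good E s'.
Proof.
case=> sM ex; have [l [b [D [bD minD D0]]]] := minimal_presentation sM (ex 0%N).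
have [gD imD] := bD.
have shift := submod_exact_shift gD imD minD.
exists (Stage b (fun u => u *m D = 0)), D; split; last first.
  by split=> [|i e eE]; [apply: ker_graded gD | apply/shift; apply: ex].
split=> //; split=> // l0 e z zM _; exists (fun=> 0).
split=> S S0; first exact: sub0 sM.
rewrite /kdX /kd big1 => [|v _]; last by rewrite scaler0.
have [v zv] := proj1 (imD _) (zM S S0).
rewrite /= in l0; subst l.
by rewrite /prz zv (thinmx0 v) mul0mx pr0.
Qed.

Lemma next_stage_fun E :
  exists nx : forall s, {s' : stage & 'M[R]_(srk s', srk s)},
  forall s, good E s -> step (projT2 (nx s)) /\ good E (projT1 (nx s)).
Proof.
have H s : exists p : {s' : stage & 'M[R]_(srk s', srk s)},
    good E s -> step (projT2 p) /\ good E (projT1 p).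
  have [gs|ngs] := classic (good E s); last first.
    by exists (existT (fun s' => 'M[R]_(srk s', srk s)) s 0).
  have [s' [D HD]] := next_stage gs.
  by exists (existT (fun s' => 'M[R]_(srk s', srk s)) s' D).
exists (fun s => proj1_sig (constructive_indefinite_description _ (H s))) => s.
exact: (proj2_sig (constructive_indefinite_description _ (H s))).
Qed.

Definition row_ideal (I : R -> Prop) (u : 'rV[R]_1) : Prop := I (u 0 0).

Local Notation deg1 := (fun _ : 'I_1 => 0%N).

(** By dimension shift, H_(n+1)(x; R/I) is the zeroth Koszul homology of the
    n-th syzygy module M of I, that is M/mM, which is zero only if M is. *)
Theorem pdim_quot_koszul (I : R -> Prop) E p :
  graded_submod deg1 (row_ideal I) ->
  (forall f, I f -> f@_0%MM = 0) ->
  (forall i e, (E <= e)%N -> quotient_exact deg1 (row_ideal I) i e) ->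
  (forall i e, (p < i)%N -> quotient_exact deg1 (row_ideal I) i e) ->
  ~ (forall e, quotient_exact deg1 (row_ideal I) p e) ->
  pdim_quot I p.
Proof.
move=> sI I0 HE Hp Np.
have m0 u : row_ideal I u -> forall j, (u 0 j)@_0%MM = 0.
  by move=> Iu j; rewrite ord1; apply: I0.
have shift := @quotient_exact_shift _ _ _ deg1 _ _ _ m0.
have [nx Hnx] := next_stage_fun E.
pose s0 := Stage deg1 (row_ideal I).
have g0 : good E s0 by split=> // i e eE; apply/shift; apply: HE.
pose st := fix st n := if n is n'.+1 then projT1 (nx (st n')) else s0.
have gst n : good E (st n) by elim: n => //= n /Hnx[].
have stD n : step (projT2 (nx (st n)) : 'M_(srk (st n.+1), srk (st n))).
  by have [] := Hnx _ (gst n).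
have exn n i e : stage_exact (st n) i e <->
    quotient_exact deg1 (row_ideal I) (i + n).+1 e.
  elim: n i => [|n IH] i; first by rewrite addn0 shift.
  by have [_ _ _ -> _] := stD n; rewrite IH addSnnS.
have rk0 n : srk (st n.+1) = 0%N <->
    forall e, quotient_exact deg1 (row_ideal I) n.+1 e.
  have [_ _ _ _ ->] := stD n.
  by split=> H e; have := H e; rewrite exn.
exists (@GFree K N (fun n => srk (st n)) (fun n => @sdeg (st n))
   (fun n => projT2 (nx (st n))) (1 : 'M_1)); last first.
  split=> [|[//|i] pi]; last by apply/rk0 => e; apply: Hp.
  case: p {Hp} Np => [//|p] Np; rewrite lt0n; apply/eqP => /rk0.
  exact: Np.
split.
- split=> /= [j m|i]; last by have [[]] := stD i.
  rewrite mxE !ord1 eqxx /= => /=; rewrite msupp1 inE => /eqP ->.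
  by rewrite mdeg0.
- split=> [f|u|i u] /=.
  + exists (const_mx f); rewrite mulmx1 mxE subrr.
    by have := sub0 sI; rewrite /row_ideal mxE.
  + by rewrite mulmx1; have [[_ im] _ _ _ _] := stD 0%N; exact: im.
  have [_ im _ _ _] := stD i; rewrite -im.
  by have [[_ im'] _ _ _ _] := stD i.+1; exact: im'.
move=> i j q /=; have [[_ im] _ m _ _] := stD i.
have H : ssub (row j (projT2 (nx (st i)))).
  by apply/im; exists (delta_mx 0 j); rewrite rowE.
case: i j q {rk0 exn} im m H => [|i] j q im m H.
  by have := m0 _ H q; rewrite mxE.
by have [_ _ m' _ _] := stD i; have := m' _ H q; rewrite mxE.
Qed.

End Resolution.

(** * Derivations of depth bounds and of nonvanishing cohomology *)

Section Derivations.

Variables (V : finType) (e : rel V).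
Implicit Types (W : {set V}) (x y : V).

Definition link x W : {set V} := [set y in W | (y != x) && ~~ e x y].

Definition isolated x W := forall y, y \in W -> ~~ e x y.

(** With the flag off, the depth of the edge ring of W is at least d.  With the
    flag on, the reduced cohomology of the independence complex of W vanishes
    on faces of fewer than d vertices; then an isolated vertex, which makes the
    complex a cone, gives every d.  Keeping derivations rather than their
    meaning lets unions and embeddings of graphs be treated by induction, with
    no Kuenneth formula. *)
Inductive depth_bound (cone : bool) : {set V} -> nat -> Prop :=
| bound_empty : depth_bound cone set0 0
| bound_branch W x d of x \in W & depth_bound cone (W :\ x) d
    & depth_bound cone (link x W) d.-1 : depth_bound cone W d
| bound_isolated W x d of x \in W & isolated x W
    & depth_bound cone (W :\ x) d : depth_bound cone W d.+1
| bound_cone W x d of cone & x \in W & isolated x W : depth_bound cone W d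
| bound_weaken W d d' of (d' <= d)%N & depth_bound cone W d :
    depth_bound cone W d'.

(** The reduced cohomology on faces of size k is nonzero: a class comes from
    the link, or from the deletion, when the other one is acyclic where the
    connecting map would meet it. *)
Inductive nonvanishing : {set V} -> nat -> Prop :=
| nonvanishing_empty : nonvanishing set0 0
| nonvanishing_link W x k of x \in W & nonvanishing (link x W) k
    & depth_bound true (W :\ x) k.+1 : nonvanishing W k.+1
| nonvanishing_del W x k of x \in W & nonvanishing (W :\ x) k
    & depth_bound true (link x W) k.+1 : nonvanishing W k.

Lemma depth_bound_cone W d : depth_bound false W d -> depth_bound true W d.
Proof.
elim=> {W d} [|W x d xW _ IH _ IH'|W x d xW iso _ IH|//|W d d' dd' _ IH].
- exact: bound_empty.
- exact: bound_branch IH IH'.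
- exact: bound_isolated IH.
- exact: bound_weaken IH.
Qed.

End Derivations.

(** * Cohomology of independence complexes *)

Section Cohomology.

Variables (K : fieldType) (N : nat) (e : rel 'I_N).
Hypotheses (e_sym : ssrbool.symmetric e) (e_irr : irreflexive e).
Implicit Types (W S T s : {set 'I_N}) (x v : 'I_N) (f g h : {set 'I_N} -> K).

(** Cochains are indexed by the complements of faces; the coboundary is then an
    instance of kd. *)
Definition cochain_d f S : K := kd (V := K^o) (fun=> 1) f S.

Definition independent W s :=
  s \subset W /\ forall u v, u \in s -> v \in s -> ~~ e u v.

Definition cocycle W k f :=
  forall s, independent W s -> #|s| = k.+1 -> cochain_d f (~: s) = 0.

Definition coboundary W k f :=
  exists g, forall s, independent W s -> #|s| = k -> f (~: s) = cochain_d g (~: s).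

Definition acyclic W k := forall f, cocycle W k f -> coboundary W k f.

(** The values of f on the faces containing x, as a cochain on the link. *)
Definition link_part x f S : K := wedge (V := K^o) x f S.

Lemma link_part_d x f S : x \in S ->
  link_part x (cochain_d f) S = f S - cochain_d (link_part x f) S.
Proof.
by move=> xS; rewrite /link_part /cochain_d wedge_kd // scale1r.
Qed.

Lemma link_part_inj x f g S : link_part x f S = link_part x g S -> f (S :\ x) = g (S :\ x).
Proof.
rewrite /link_part /wedge /GRing.scale /= => /mulfI; apply.
by rewrite signr_eq0.
Qed.

Lemma eq_cochain_d f g S :
  (forall v, v \notin S -> f (v |: S) = g (v |: S)) ->
  cochain_d f S = cochain_d g S.
Proof. by move=> H; apply: (@eq_kd _ K^o). Qed.

Lemma cochain_d0 S : cochain_d (fun=> 0) S = 0.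
Proof. by rewrite /cochain_d /kd big1 // => v _; rewrite scaler0. Qed.

Lemma cochain_dB f g S :
  cochain_d (fun T => f T - g T) S = cochain_d f S - cochain_d g S.
Proof. exact: (@kd_sub _ K^o). Qed.

Lemma cochain_dd f S : cochain_d (cochain_d f) S = 0.
Proof. exact: (@kd_kd _ K^o). Qed.

(** A complement contains x if and only if the face avoids it: the cochain below
    lives on the faces of the deletion, extend x h on those containing x. *)
Definition restrict_to x f S : K := if x \in S then f S else 0.
Definition extend x h S : K :=
  if x \in S then 0 else (-1) ^+ rank_in x S * h (x |: S).

Lemma link_part_extend x h S : x \in S -> link_part x (extend x h) S = h S.
Proof.
move=> xS; rewrite /link_part /wedge /extend setD11 setD1K // /GRing.scale /=.
by rewrite mulrA -expr2 sqrr_sign mul1r.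
Qed.

Lemma link_part_restrict x f S : link_part x (restrict_to x f) S = 0.
Proof. by rewrite /link_part /wedge /restrict_to setD11 scaler0. Qed.

Lemma d_restrict x f S : x \in S ->
  cochain_d (restrict_to x f) S = cochain_d f S.
Proof.
by move=> xS; apply: eq_cochain_d => v _; rewrite /restrict_to !inE xS orbT.
Qed.

Lemma d_extend x h S : x \in S -> cochain_d (extend x h) S = 0.
Proof.
move=> xS; rewrite -[RHS](cochain_d0 S); apply: eq_cochain_d => v _.
by rewrite /extend !inE xS orbT.
Qed.

Lemma link_part_ext x f g S : f (S :\ x) = g (S :\ x) -> link_part x f S = link_part x g S.
Proof. by rewrite /link_part /wedge => ->. Qed.

Lemma link_part_add x f g S :
  link_part x (fun T => f T + g T) S = link_part x f S + link_part x g S.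
Proof. by rewrite /link_part /wedge scalerDr. Qed.

Lemma cochain_dD f g S :
  cochain_d (fun T => f T + g T) S = cochain_d f S + cochain_d g S.
Proof. exact: (@kd_add _ K^o). Qed.

(** ** Faces of the deletion and of the link *)

Lemma independent_del W x s :
  independent (W :\ x) s <-> independent W s /\ x \notin s.
Proof.
rewrite /independent subsetD1; split=> [[/andP[-> ->]]|[[-> is_s] ->]] //.
Qed.

Lemma independent_link W x s : x \in W ->
  independent (link e x W) s <-> independent W (x |: s) /\ x \notin s.
Proof.
move=> xW; split=> [[sW is_s]|[[sW is_s] xs]].
  have xs : x \notin s by apply/negP => /(subsetP sW); rewrite !inE eqxx andbF.
  split=> //; split.
    apply/subsetP => y; rewrite !inE => /orP[/eqP -> //|/(subsetP sW)].
    by rewrite inE => /andP[].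
  move=> u v; rewrite !inE => /orP[/eqP ->|us] /orP[/eqP ->|vs].
  - by rewrite e_irr.
  - by have := subsetP sW v vs; rewrite !inE => /and3P[].
  - by have := subsetP sW u us; rewrite !inE e_sym => /and3P[].
  - exact: is_s.
split.
  apply/subsetP => y ys; rewrite !inE.
  rewrite (subsetP sW) ?inE ?ys ?orbT //=.
  rewrite is_s ?inE ?eqxx ?ys ?orbT // andbT.
  by apply: contraNneq xs => <-.
by move=> u v us vs; apply: is_s; rewrite inE ?us ?vs orbT.
Qed.

Lemma independent_link_sub W x s :
  independent (link e x W) s -> independent (W :\ x) s.
Proof.
case=> sW is_s; split=> //; apply: subset_trans sW _.
by apply/subsetP => y; rewrite !inE => /and3P[-> -> _].
Qed.

Lemma setCU1D x s : x \notin s -> ~: s :\ x = ~: (x |: s).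
Proof. by move=> xs; apply/setP => y; rewrite !inE negb_or. Qed.

Lemma link_faceP W x s k : x \in W -> x \in s -> independent W s -> #|s| = k.+1 ->
  [/\ independent (link e x W) (s :\ x), #|s :\ x| = k
    & ~: (s :\ x) :\ x = ~: s].
Proof.
move=> xW xs is_s sk; split.
- by apply/independent_link; rewrite // setD1K // setD11.
- by apply/eqP; rewrite -eqSS -sk [X in _ == X](cardsD1 x) xs.
- by rewrite setCU1D ?setD11 // setD1K.
Qed.

Lemma face_eq W x s k f g : x \in W -> x \in s -> independent W s -> #|s| = k.+1 ->
  link_part x f (~: (s :\ x)) = link_part x g (~: (s :\ x)) -> f (~: s) = g (~: s).
Proof.
move=> xW xs is_s sk /link_part_inj.
by have [_ _ ->] := link_faceP xW xs is_s sk.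
Qed.

(** Solve on the deletion first; what remains is supported on the faces
    containing x and is a cocycle of the link. *)
Lemma acyclic_branch W x k : x \in W -> acyclic (W :\ x) k ->
  (0 < k -> acyclic (link e x W) k.-1)%N -> acyclic W k.
Proof.
move=> xW Adel Alink f cf.
have [|g Hg] := Adel f.
  by move=> s /independent_del[is_s _]; apply: cf.
case: k Alink Adel Hg cf => [|k] /= Alink Adel Hg cf.
  exists g => s is_s s0; apply: Hg => //; apply/independent_del; split=> //.
  by move/eqP: s0; rewrite cards_eq0 => /eqP ->; rewrite inE.
pose g' := restrict_to x g; pose f' T := f T - cochain_d g' T.
have f'0 s : independent (W :\ x) s -> #|s| = k.+1 -> f' (~: s) = 0.
  move=> is_s sk; have [_ xs] := proj1 (independent_del _ _ _) is_s.
  by rewrite /f' (Hg s) // /g' d_restrict ?subrr // inE.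
have [s is_s sk|h Hh] := Alink isT (link_part x f').
  have [is_xs xs] := proj1 (independent_link _ xW) is_s.
  have -> : cochain_d (link_part x f') (~: s) =
      f' (~: s) - link_part x (cochain_d f') (~: s).
    by rewrite link_part_d ?inE // opprB addrC subrK.
  rewrite f'0 //; last exact: independent_link_sub.
  rewrite sub0r /link_part /wedge setCU1D // cochain_dB cochain_dd subr0.
  by rewrite cf ?scaler0 ?oppr0 // cardsU1 xs sk.
exists (fun T => g' T + extend x (fun U => - h U) T) => s is_s sk.
rewrite cochain_dD; have [xs|xs] := boolP (x \in s); last first.
  rewrite d_extend ?inE // addr0 d_restrict ?inE //.
  by apply: Hg => //; apply/independent_del.
suff : f' (~: s) = cochain_d (extend x (fun U => - h U)) (~: s).
  by move=> <-; rewrite /f' addrC subrK.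
apply: (face_eq xW xs is_s sk).
have [is_sx skx Es] := link_faceP xW xs is_s sk.
have xC : x \in ~: (s :\ x) by rewrite !inE eqxx.
rewrite Hh // link_part_d // {1}/extend xC sub0r.
transitivity (- cochain_d (fun U => 0 - h U) (~: (s :\ x))).
  by rewrite cochain_dB cochain_d0 sub0r opprK.
congr (- _); apply: eq_cochain_d => v _.
by rewrite link_part_extend ?sub0r // !inE eqxx orbT.
Qed.

(** The independence complex is a cone with apex x. *)
Lemma acyclic_cone W x k : x \in W -> isolated e x W -> acyclic W k.
Proof.
move=> xW iso f cf; pose g := restrict_to x (link_part x f).
exists g => s is_s sk; have [xs|xs] := boolP (x \in s); last first.
  have xC : x \in ~: s by rewrite inE.
  rewrite d_restrict //; have := link_part_d f xC.
  rewrite /link_part {1}/wedge setCU1D // -/(link_part x f) cf ?scaler0.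
  - by move/esym/eqP; rewrite subr_eq0 => /eqP.
  - case: is_s => sW is_s; split.
      by apply/subsetP => y; rewrite !inE => /orP[/eqP -> //|/(subsetP sW)].
    move=> u v; rewrite !inE => /orP[/eqP ->|us] /orP[/eqP ->|vs].
    + exact: iso.
    + exact/iso/(subsetP sW).
    + by rewrite e_sym; apply/iso/(subsetP sW).
    + exact: is_s.
  by rewrite cardsU1 xs sk.
case: k sk cf => [|k] sk cf; first by move/eqP: sk xs; rewrite cards_eq0 => /eqP ->; rewrite inE.
apply: (face_eq xW xs is_s sk).
have xC : x \in ~: (s :\ x) by rewrite !inE eqxx.
rewrite link_part_d // {1}/g /restrict_to xC.
rewrite [X in _ - X](_ : _ = 0) ?subr0 // -[RHS](cochain_d0 (~: (s :\ x))).
by apply: eq_cochain_d => v _; rewrite link_part_restrict.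
Qed.

Lemma depth_bound_acyclic W d k :
  depth_bound e true W d -> (k < d)%N -> acyclic W k.
Proof.
move=> H; elim: H k => {W d}
  [|W x d xW _ IH _ IH'|W x d xW iso _ _|W x d _ xW iso|W d d' dd' _ IH] k kd //.
- apply: (acyclic_branch xW (IH k kd)) => k0; apply: IH'.
  by move: k0 kd; clear; lia.
- exact: acyclic_cone iso.
- exact: acyclic_cone iso.
- exact/IH/(leq_trans kd).
Qed.

(** A class of the link is extended by zero, one of the deletion by a solution
    on the link of the obstruction to extending it; acyclicity of the third
    term prevents the result from becoming a coboundary, or provides that
    solution. *)
Lemma nonvanishing_cocycle W k : nonvanishing e W k ->
  exists f, cocycle W k f /\ ~ coboundary W k f.
Proof.
elim=> {W k} [|W x k xW _ [f [cf nf]] ac|W x k xW _ [f [cf nf]] ac].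
- exists (fun=> 1); split=> [s [s0 _] s1|[g Hg]].
    by have := subset_leq_card s0; rewrite cards0 s1.
  have : independent set0 set0.
    by split=> [|u v]; rewrite ?sub0set // inE.
  move=> /Hg/(_ (cards0 _)); rewrite /cochain_d /kd big1 => [/eqP|v].
    by rewrite oner_eq0.
  by rewrite !inE.
- exists (extend x f); split.
    move=> s is_s sk; have [xs|xs] := boolP (x \in s); last first.
      by rewrite d_extend // inE.
    have [is_sx skx Es] := link_faceP xW xs is_s sk.
    have xC : x \in ~: (s :\ x) by rewrite !inE eqxx.
    apply: (face_eq (g := fun=> 0) xW xs is_s sk).
    rewrite link_part_d // {1}/extend xC sub0r /link_part [RHS]/wedge scaler0.
    apply/eqP; rewrite oppr_eq0; apply/eqP.
    rewrite -[RHS](cf _ is_sx skx); apply: eq_cochain_d => v _.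
    by rewrite -/(link_part _ _ _) link_part_extend // !inE eqxx orbT.
  case=> g Hg; apply: nf.
  have [|h Hh] := depth_bound_acyclic ac (ltnSn k) (f := g).
    move=> s /independent_del[is_s xs] sk.
    by rewrite -Hg // /extend inE xs.
  exists (fun T => h T - link_part x g T) => s is_s sk.
  have [is_xs xs] := proj1 (independent_link _ xW) is_s.
  have xC : x \in ~: s by rewrite inE.
  rewrite cochain_dB -Hh //; last exact: independent_link_sub.
  rewrite -link_part_d // -[LHS](link_part_extend f xC); apply: link_part_ext.
  by rewrite setCU1D // Hg // cardsU1 xs sk.
have [|h Hh] := depth_bound_acyclic ac (ltnSn k) (f := f).
  by move=> s /independent_link_sub; apply: cf.
exists (fun T => restrict_to x f T + extend x h T); split.
  move=> s is_s sk; have [xs|xs] := boolP (x \in s); last first.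
    rewrite cochain_dD d_extend ?inE // addr0 d_restrict ?inE //.
    by apply: cf => //; apply/independent_del.
  have [is_sx skx Es] := link_faceP xW xs is_s sk.
  have xC : x \in ~: (s :\ x) by rewrite !inE eqxx.
  apply: (face_eq (g := fun=> 0) xW xs is_s sk).
  rewrite link_part_d // {1}/extend {1}/restrict_to xC addr0 Hh //.
  rewrite /link_part [RHS]/wedge scaler0; apply/eqP; rewrite subr_eq0; apply/eqP.
  apply: eq_cochain_d => v _; rewrite -/(link_part _ _ _) link_part_add link_part_restrict.
  by rewrite add0r link_part_extend // !inE eqxx orbT.
case=> g Hg; apply: nf; exists g => s /independent_del[is_s xs] sk.
by rewrite -Hg // /extend /restrict_to inE xs addr0.
Qed.

End Cohomology.

(** * Koszul homology of edge ideals *)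

Section EdgeIdeals.

Variables (K : fieldType) (N : nat).
Local Notation R := {mpoly K[N]}.
Local Notation deg1 := (fun _ : 'I_1 => 0%N).
Implicit Types (m : 'X_{1..N}) (P : 'X_{1..N} -> Prop).

Definition monomial_ideal P (f : R) : Prop := forall m, m \in msupp f -> P m.

Definition upward P := forall m m', P m -> P (m' + m)%MM.

Lemma monomial_ideal_graded P : upward P ->
  graded_submod deg1 (row_ideal (monomial_ideal P)).
Proof.
move=> uP; split.
- by move=> m; rewrite mxE msupp0.
- move=> u t Iu It m; rewrite mxE => /msuppD_le.
  by rewrite mem_cat => /orP[/Iu|/It].
- move=> f u Iu m; rewrite mxE => /msuppM_le/allpairsP[[m1 m2] [_ m2u ->]].
  exact/uP/Iu.
move=> s e u Iu m; rewrite mxE mcoeff_msupp mcoeff_proj.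
by case: ifP => [_ mu|_]; [apply: Iu; rewrite mcoeff_msupp | rewrite eqxx].
Qed.

Lemma monomial_ideal_colon P x u :
  row_ideal (monomial_ideal (fun m => P (U_(x) + m)%MM)) u <->
  row_ideal (monomial_ideal P) ('X_x *: u).
Proof.
rewrite /row_ideal mxE mulrC; split=> H m.
  by rewrite (perm_mem (msuppMX _ _)) => /mapP[m' /H + ->].
by move=> mu; apply: H; rewrite (perm_mem (msuppMX _ _)); apply: map_f.
Qed.

Lemma monomial_ideal_addX P x u :
  row_ideal (monomial_ideal (fun m => P m \/ (0 < m x)%N)) u <->
  exists t, row_ideal (monomial_ideal P) (u - 'X_x *: t).
Proof.
rewrite /row_ideal; split=> [H|[t H] m mu].
  exists (const_mx (divX x (u 0 0))) => m; rewrite !mxE {1}(divXK x (u 0 0)).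
  rewrite [in X in X - _]addrC addrK mcoeff_msupp mcoeff_restrict.
  case: ifP => [/eqP mx mu|_]; last by rewrite eqxx.
  by have [|//|] := H m; rewrite ?mx // mcoeff_msupp.
have [mx|mx] := posnP (m x); last by right.
left; apply: H; rewrite !mxE mcoeff_msupp mcoeffB mcoeffXM mx subr0.
by rewrite -mcoeff_msupp.
Qed.

Lemma monomial_ideal_ext P P' : (forall m, P m <-> P' m) ->
  forall u, row_ideal (monomial_ideal P) u <-> row_ideal (monomial_ideal P') u.
Proof. by move=> PP' u; split=> H m /H /PP'. Qed.

Variable (e : rel 'I_N).
Hypotheses (e_sym : ssrbool.symmetric e) (e_irr : irreflexive e).
Implicit Types (W A : {set 'I_N}) (x v : 'I_N).

(** The monomials of the ideal generated by the variables of A and the edges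
    inside W; variables outside both sets are free. *)
Definition edge_monomial W A m : Prop :=
  (exists2 v, v \in A & (0 < m v)%N) \/
  (exists u v, [/\ u \in W, v \in W, e u v, (0 < m u)%N & (0 < m v)%N]).

Definition graph_ideal W A := row_ideal (monomial_ideal (edge_monomial W A)).

Lemma edge_monomial_upward W A : upward (edge_monomial W A).
Proof.
move=> m m' [[v vA mv]|[u [v [uW vW uv mu mv]]]]; [left|right].
  by exists v => //; rewrite mnmDE ltn_addl.
by exists u, v; split=> //; rewrite mnmDE ltn_addl.
Qed.

Lemma graph_ideal_graded W A : graded_submod deg1 (graph_ideal W A).
Proof. exact/monomial_ideal_graded/edge_monomial_upward. Qed.

Lemma edge_monomial_colon W A x m : x \in W -> x \notin A ->
  edge_monomial (link e x W) (A :|: [set y in W | e x y]) m <->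
  edge_monomial W A (U_(x) + m)%MM.
Proof.
move=> xW xA.
have mE v : (0 < (U_(x) + m)%MM v)%N = (x == v) || (0 < m v)%N.
  by rewrite mnmDE mnm1E; case: (x == v).
split.
  case=> [[v]|[u [v [uW vW uv mu mv]]]].
    rewrite !inE => /orP[vA|/andP[vW xv]] mv.
      by left; exists v; rewrite // mE mv orbT.
    by right; exists x, v; split; rewrite // mE ?eqxx ?mv ?orbT.
  right; exists u, v; rewrite !mE mu mv !orbT; split=> //.
    by move: uW; rewrite inE => /and3P[].
  by move: vW; rewrite inE => /and3P[].
case=> [[v vA]|[u [v [uW vW uv]]]].
  rewrite mE; case: eqP => [E|_ /= mv]; first by rewrite E vA in xA.
  by left; exists v; rewrite // inE vA.
rewrite !mE; have [xu _|xu /= mu] := eqVneq x u.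
  rewrite -{}xu {u uW} in uv *; have [xv|xv /= mv] := eqVneq x v.
    by rewrite -xv e_irr in uv.
  by left; exists v; rewrite // !inE vW uv orbT.
have [xv _|xv /= mv] := eqVneq x v.
  by left; exists u; rewrite // !inE uW e_sym xv uv orbT.
have [xeu|xeu] := boolP (e x u).
  by left; exists u; rewrite // !inE uW xeu orbT.
have [xev|xev] := boolP (e x v).
  by left; exists v; rewrite // !inE vW xev orbT.
right; exists u, v; split=> //; rewrite inE.
  by rewrite uW eq_sym xu.
by rewrite vW eq_sym xv.
Qed.

Lemma edge_monomial_addX W A x m : x \in W ->
  edge_monomial (W :\ x) (x |: A) m <-> edge_monomial W A m \/ (0 < m x)%N.
Proof.
move=> xW; split.
  case=> [[v]|[u [v [uW vW uv mu mv]]]].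
    rewrite !inE => /orP[/eqP -> mx|vA mv]; first by right.
    by left; left; exists v.
  left; right; exists u, v; split=> //.
    by move: uW; rewrite inE => /andP[].
  by move: vW; rewrite inE => /andP[].
have R0 : (0 < m x)%N -> edge_monomial (W :\ x) (x |: A) m.
  by left; exists x; rewrite ?setU11.
case=> [[[v vA mv]|[u [v [uW vW uv mu mv]]]]|//].
  by left; exists v; rewrite // inE vA orbT.
have [E|ux] := eqVneq u x; first by apply: R0; rewrite -E.
have [E|vx] := eqVneq v x; first by apply: R0; rewrite -E.
by right; exists u, v; split; rewrite // inE ?uW ?vW ?inE ?ux ?vx.
Qed.

Lemma edge_monomial_isolated W A x m : isolated e x W ->
  edge_monomial (W :\ x) A m <-> edge_monomial W A m.
Proof.
move=> iso; split; (case=> [H|[u [v [uW vW uv mu mv]]]]; [by left|]); right;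
  exists u, v; split=> //.
- by move: uW; rewrite inE => /andP[].
- by move: vW; rewrite inE => /andP[].
- rewrite !inE uW andbT; apply: contraTneq uv => ->; exact: iso.
rewrite !inE vW andbT; apply: contraTneq uv => ->; rewrite e_sym; exact: iso.
Qed.

Lemma zero_ideal_exact i d : (0 < i)%N \/ (0 < d)%N ->
  quotient_exact deg1 (graph_ideal set0 set0) i d.
Proof.
move=> id z cz.
have L0 u : graph_ideal set0 set0 u <-> u = 0.
  split=> [H|->]; last exact: sub0 (graph_ideal_graded _ _).
  apply/rowP => j; rewrite ord1 mxE; apply/mpolyP => m; rewrite mcoeff0.
  apply/eqP; rewrite mcoeff_eq0; apply/negP => /H.
  by case=> [[v]|[u' [v []]]]; rewrite inE.
have [S Si|i0 j|w Hw] := @koszul_exact _ _ _ (prz deg1 d z) i.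
- by rewrite -pr_kd (proj1 (L0 _) (cz S Si)) pr0.
- rewrite i0 in id; case: id => // d0.
  rewrite /prz mxE mcoeff_proj mdeg0 cards0 !add0n.
  by rewrite eq_sym -[_ == _]negbK -lt0n d0.
by exists w => S Si; apply/L0; rewrite Hw // subrr.
Qed.

Lemma variables_exact A i d : (#|A| < i)%N \/ (#|A| < d)%N ->
  quotient_exact deg1 (graph_ideal set0 A) i d.
Proof.
elim: {A}#|A| {-2}A (erefl #|A|) i d => [|n IH] A An i d Aid.
  move: Aid; rewrite ?An; move/eqP: An; rewrite cards_eq0 => /eqP ->.
  exact: zero_ideal_exact.
have [x xA] : exists x, x \in A by apply/set0Pn; rewrite -cards_eq0 An.
have An' : #|A :\ x| = n by move: An; rewrite (cardsD1 x) xA => -[].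
apply: (@quotient_exact_ext _ _ _ _
  (fun u => exists t, graph_ideal set0 (A :\ x) (u - 'X_x *: t))).
  move=> u; rewrite -monomial_ideal_addX; apply: monomial_ideal_ext => m.
  split.
    case=> [[[v]|[u' [v []]]]|mx]; rewrite ?inE //; last by left; exists x.
    by case/andP=> _ vA mv; left; exists v.
  case=> [[v vA mv]|[u' [v []]]]; last by rewrite inE.
  have [<-|vx] := eqVneq v x; first by right.
  by left; left; exists v; rewrite // !inE vx.
apply: quotient_exact_regular.
- exact: graph_ideal_graded.
- move=> u H m mu; have : edge_monomial set0 (A :\ x) (U_(x) + m)%MM.
    by have := proj2 (monomial_ideal_colon _ _ _) H; apply.
  case=> [[v vA]|[u' [v []]]]; last by rewrite inE.
  move: (vA); rewrite !inE => /andP[vx _]; rewrite mnmDE mnm1E eq_sym.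
  by rewrite (negbTE vx) => mv; left; exists v.
- by move=> i' d' ii' dd'; apply: IH => //; lia.
by apply: IH => //; lia.
Qed.

Lemma card_link W A x : x \in W -> [disjoint A & W] ->
  (#|A :|: [set y in W | e x y]| + #|link e x W|)%N = (#|A| + #|W|).-1%N.
Proof.
move=> xW AW.
have -> : #|A :|: [set y in W | e x y]| = (#|A| + #|[set y in W | e x y]|)%N.
  apply/eqP; rewrite eq_sym; apply/eqP/esym; rewrite cardsU.
  rewrite (_ : A :&: _ = set0) ?cards0 ?subn0 //.
  apply/setP => y; rewrite !inE; apply/negP => /and3P[yA yW _].
  by have := disjointFr AW yA; rewrite yW.
have -> : #|W| = (1 + #|[set y in W | e x y]| + #|link e x W|)%N.
  rewrite (cardsD1 x W) xW -addnA; congr (_ + _)%N.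
  rewrite -(cardsID [set y | e x y] (W :\ x)); congr (_ + _)%N; apply: eq_card => y.
    rewrite !inE; case: eqP => [->|_] //=; by rewrite e_irr andbF.
  by rewrite !inE; case: (y != x); case: (y \in W); case: (e x y).
rewrite -addnA addnA; lia.
Qed.

(** Passing to the link moves the neighbours of x from W to A and drops x, while
    passing to the deletion moves x to A: hence the bounds in terms of
    #|A| + #|W|.  The second one, on internal degrees, is what makes all syzygy
    modules finitely generated. *)
Lemma depth_bound_exact W d : depth_bound e false W d ->
  forall A i q, [disjoint A & W] ->
  (#|A| + #|W| < i + d)%N \/ (#|A| + #|W| < q)%N ->
  quotient_exact deg1 (graph_ideal W A) i q.
Proof.
elim=> {W d} [|W x d xW _ IHd _ IHl|W x d xW iso _ IH|//|W d d' dd' _ IH] A i q AW.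
- by rewrite cards0 !addn0; apply: variables_exact.
- move=> bnd.
  have xA : x \notin A by apply/negP => /(disjointFr AW); rewrite xW.
  have Wx : #|W| = #|W :\ x|.+1 by rewrite (cardsD1 x W) xW.
  apply: (@quotient_exact_branch _ _ _ _ _ x).
  + exact: graph_ideal_graded.
  + move=> q' qq'.
    apply: quotient_exact_ext (IHl (A :|: [set y in W | e x y]) i q' _ _).
    * move=> u; rewrite /graph_ideal -monomial_ideal_colon.
      by apply: monomial_ideal_ext => m; apply: edge_monomial_colon.
    * rewrite disjoint_subset; apply/subsetP => y; rewrite !inE.
      case/orP=> [yA|/andP[_ ->]]; last by rewrite !andbF.
      by rewrite (disjointFr AW yA).
    rewrite card_link //; clear -Wx bnd qq'; move: Wx bnd.
    by move: #|A| #|W| #|W :\ x| => ca cw cd; lia.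
  apply: quotient_exact_ext (IHd (x |: A) i q _ _).
  + move=> u; rewrite /graph_ideal -monomial_ideal_addX.
    by apply: monomial_ideal_ext => m; apply: edge_monomial_addX.
  + rewrite disjoint_subset; apply/subsetP => y; rewrite !inE.
    case/orP=> [/eqP ->|yA]; first by rewrite eqxx.
    by rewrite (disjointFr AW yA) andbF.
  rewrite cardsU1 xA; clear -Wx bnd; move: Wx bnd.
  by move: #|A| #|W| #|W :\ x| => ca cw cd /=; lia.
- move=> bnd; have Wx : #|W| = #|W :\ x|.+1 by rewrite (cardsD1 x W) xW.
  apply: quotient_exact_ext (IH A i q _ _).
  + by apply: monomial_ideal_ext => m; apply: edge_monomial_isolated.
  + by apply: disjointWr AW; apply: subD1set.
  clear -Wx bnd; move: Wx bnd.
  by move: #|A| #|W| #|W :\ x| => ca cw cd; lia.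
move=> bnd; apply: IH => //; clear -dd' bnd; move: bnd.
by move: #|A| #|W| => ca cw; lia.
Qed.

End EdgeIdeals.

Section SquarefreeDegree.

Variables (K : fieldType) (N : nat) (e : rel 'I_N).
Hypotheses (e_sym : ssrbool.symmetric e) (e_irr : irreflexive e).
Local Notation R := {mpoly K[N]}.
Local Notation deg1 := (fun _ : 'I_1 => 0%N).
Implicit Types (S T s : {set 'I_N}).

Definition squarefree S : 'X_{1..N} := [multinom (i \in S : nat) | i < N].

Lemma mdeg_squarefree S : mdeg (squarefree S) = #|S|.
Proof.
rewrite mdegE -sum1_card [RHS]big_mkcond /=; apply: eq_bigr => i _.
by rewrite mnmE; case: (i \in S).
Qed.

Lemma squarefreeU1 v S : v \notin S ->
  (U_(v) + squarefree S)%MM = squarefree (v |: S).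
Proof.
move=> vS; apply/mnmP => i; rewrite mnmDE mnm1E !mnmE !inE eq_sym.
by case: eqP => [->|]; rewrite //= (negbTE vS).
Qed.

Lemma edge_monomial_squarefree s :
  ~ independent e setT s <-> edge_monomial e setT set0 (squarefree s).
Proof.
split=> [nind|[[v]|[u [v [_ _ uv]]]]]; last 2 first.
- by rewrite inE.
- rewrite !mnmE !lt0b => us vs [_ /(_ u v us vs)].
  by rewrite uv.
right; apply: NNPP => none; apply: nind; split; first exact: subsetT.
move=> u v us vs; apply/negP => uv; apply: none; exists u, v.
by rewrite !inE !mnmE us vs.
Qed.

(** In squarefree degree the Koszul complex of the edge ring is the cochain
    complex of the independence complex, so a cohomology class gives a Koszul
    class. *)
Lemma nonvanishing_not_exact d : nonvanishing e setT d ->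
  (d <= N)%N /\ ~ quotient_exact deg1 (graph_ideal (K := K) e setT set0) (N - d) N.
Proof.
case/(@nonvanishing_cocycle K N e e_sym e_irr) => f [cf nf].
have dN : (d <= N)%N.
  rewrite leqNgt; apply/negP => Nd; apply: nf; exists (fun=> 0) => s _ sd.
  by move: Nd; rewrite -sd -{1}(card_ord N) ltnNge max_card.
split=> // H; apply: nf.
pose z S : 'rV[R]_1 := const_mx ((f S)%:MP * 'X_[squarefree (~: S)]).
have kdz S : kdX z S 0 0 = (cochain_d f S)%:MP * 'X_[squarefree (~: S)].
  rewrite kdX_row /kdX /cochain_d /kd raddf_sum mulr_suml /=.
  apply: eq_bigr => v vS; rewrite !mxE /GRing.scale /= mulr1.
  rewrite mpolyCM mulrCA -!mulrA -mpolyXD squarefreeU1; last first.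
    by rewrite !inE eqxx.
  have -> : v |: ~: (v |: S) = ~: S.
    by apply/setP => i; rewrite !inE; case: eqP => [->|].
  by rewrite mulrCA rmorph_sign.
have cz S : #|S|.+1 = (N - d)%N -> graph_ideal (K := K) e setT set0 (kdX z S).
  move=> Sd m; rewrite kdz mcoeff_msupp mcoeffCM mcoeffX.
  have [<-|_] := eqVneq (squarefree (~: S)) m; last by rewrite mulr0 eqxx.
  rewrite mulr1 => nz; apply/edge_monomial_squarefree => ind.
  move: nz; rewrite -[S]setCK cf ?eqxx //.
  by have := cardsC S; rewrite card_ord; lia.
have [w Hw] := H z cz.
exists (fun T => (w T 0 0)@_(squarefree (~: T))) => s is_s sd.
have Sd : #|~: s| = (N - d)%N by have := cardsC s; rewrite card_ord; lia.
have /eqP : ((prz deg1 N z (~: s) - kdX w (~: s)) 0 0)@_(squarefree s) = 0.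
  apply/eqP; rewrite mcoeff_eq0; apply/negP => /(Hw _ Sd).
  by move/edge_monomial_squarefree; apply.
rewrite !mxE mcoeffB mcoeff_proj mdeg_squarefree Sd.
rewrite (_ : _ == N); last by apply/eqP; lia.
rewrite mcoeffCM setCK mcoeffX eqxx mulr1 subr_eq0 => /eqP ->.
rewrite kdX_row /kdX /cochain_d /kd raddf_sum /=; apply: eq_bigr => v vs.
rewrite /GRing.scale /= mulr1 -mulrA mcoeff_signM; congr (_ * _).
have vs' : v \in s by move: vs; rewrite inE negbK.
have -> : squarefree s = (squarefree (s :\ v) + U_(v))%MM.
  by rewrite addmC squarefreeU1 ?setD11 // setD1K.
rewrite mcoeffXM mnmDE mnm1E eqxx addn1 /= addmK; congr (_@_(squarefree _)).
by apply/setP => i; rewrite !inE negb_or negbK.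
Qed.

Lemma edge_idealP (G : sgraph N) (f : R) :
  edge_ideal G f <-> monomial_ideal (edge_monomial G setT set0) f.
Proof.
have uP := edge_monomial_upward (e := G) (W := setT) (A := set0).
have [P0 PD PZ _] := monomial_ideal_graded K uP.
split=> [[c ->]|].
  have sum I (r : seq I) (P : pred I) (F : I -> R) :
      (forall i, P i -> monomial_ideal (edge_monomial G setT set0) (F i)) ->
      monomial_ideal (edge_monomial G setT set0) (\sum_(i <- r | P i) F i).
    apply: big_ind => [|x y Hx Hy].
      by have := P0; rewrite /row_ideal mxE.
    by have := PD (const_mx x) (const_mx y); rewrite /row_ideal !mxE; apply.
  apply: (sum) => i _; apply: sum => j Gij m.
  rewrite -mpolyXD (perm_mem (msuppMX _ _)) => /mapP[m' _ ->].
  right; exists i, j; rewrite !inE !mnmDE !mnm1E !eqxx.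
  by split=> //; rewrite ?addn1 ?add1n // !addSn addnC.
have E0 : edge_ideal G (0 : R).
  exists (fun _ _ => 0); rewrite big1 // => i _; rewrite big1 // => j _.
  by rewrite mul0r.
have ED (x y : R) : edge_ideal G x -> edge_ideal G y -> edge_ideal G (x + y).
  case=> c -> [c' ->]; exists (fun i j => c i j + c' i j).
  rewrite -big_split; apply: eq_bigr => i _; rewrite -big_split.
  by apply: eq_bigr => j _; rewrite mulrDl.
move=> Hf; rewrite [f]mpolyE big_seq.
apply: (big_ind (edge_ideal G) E0 ED) => m /Hf.
case=> [[v]|[u [v [_ _ uv mu mv]]]]; first by rewrite inE.
have uvn : u != v by apply: contraTneq uv => ->; rewrite adj_irr.
exists (fun i j => if (i == u) && (j == v) then f@_m *: 'X_[m - (U_(u) + U_(v))] else 0).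
rewrite (bigD1 u) //= (bigD1 v) //= !eqxx /= big1 => [|j /andP[_ /negbTE ->]];
  last by rewrite mul0r.
rewrite big1 => [|i /negbTE ->]; last first.
  by rewrite big1 // => j _; rewrite mul0r.
rewrite !addr0 -scalerAl -!mpolyXD submK //; apply/mnm_lepP => i.
rewrite mnmDE !mnm1E; case: eqP => [<-|_]; case: eqP => [E|_] //.
- by rewrite E eqxx in uvn.
- by rewrite -E.
Qed.

End SquarefreeDegree.

(** A depth bound matched by a nonvanishing class computes the projective
    dimension. *)
Theorem pdim_edge_ideal (K : fieldType) N (G : sgraph N) d :
  depth_bound G false setT d -> nonvanishing G setT d ->
  pdim_quot (edge_ideal (K := K) G) (N - d).
Proof.
move=> Hd Hn; have [dN nex] := nonvanishing_not_exact K (@adj_sym _ G) (@adj_irr _ G) Hn.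
have GE u : graph_ideal (K := K) G setT set0 u <-> row_ideal (edge_ideal G) u.
  by rewrite /graph_ideal /row_ideal edge_idealP.
have ex i q : (N < i + d)%N \/ (N < q)%N ->
    quotient_exact (fun _ : 'I_1 => 0%N) (row_ideal (edge_ideal (K := K) G)) i q.
  move=> iq; apply: quotient_exact_ext GE _.
  apply: (depth_bound_exact (@adj_sym _ G) (@adj_irr _ G) Hd).
    by rewrite -setI_eq0 set0I.
  by rewrite cards0 add0n cardsT card_ord.
apply: (@pdim_quot_koszul _ _ _ N.+1).
- have [g0 gD gZ gP] := graph_ideal_graded K G setT set0.
  split; first exact/GE.
  + by move=> u t /GE Hu /GE Ht; apply/GE; apply: gD.
  + by move=> f u /GE Hu; apply/GE; apply: gZ.
  by move=> s q u /GE Hu; apply/GE; apply: gP.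
- move=> f /edge_idealP Hf; apply/eqP; rewrite mcoeff_eq0; apply/negP => /Hf.
  by case=> [[v]|[u [v [_ _ _]]]]; rewrite ?inE // mnm0E.
- by move=> i q Nq; apply: ex; right.
- by move=> i q Ni; apply: ex; left; lia.
move=> H; apply: nex; apply: quotient_exact_ext (H N) => u.
exact: iff_sym.
Qed.

(** * Disjoint unions and embeddings *)

Section Unions.

Variables (V : finType) (e : rel V).
Implicit Types (W : {set V}) (x y : V).

Definition apart W W' :=
  forall x y, x \in W -> y \in W' -> (x != y) && ~~ e x y.

Lemma apart_sub W W0 W' : W0 \subset W -> apart W W' -> apart W0 W'.
Proof. by move=> /subsetP s aW x y /s; apply: aW. Qed.

Lemma link_sub x W : link e x W \subset W.
Proof. by apply/subsetP => y; rewrite inE => /andP[]. Qed.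

Lemma setD1_union W W' x : x \in W -> apart W W' ->
  (W :|: W') :\ x = (W :\ x) :|: W'.
Proof.
move=> xW aW; apply/setP => y; rewrite !inE.
case: (boolP (y \in W')) => [yW'|_]; rewrite ?orbF // !orbT andbT.
by have /andP[+ _] := aW x y xW yW'; rewrite eq_sym.
Qed.

Lemma link_union W W' x : x \in W -> apart W W' ->
  link e x (W :|: W') = link e x W :|: W'.
Proof.
move=> xW aW; apply/setP => y; rewrite !inE.
case: (boolP (y \in W')) => [yW'|_]; rewrite ?orbF // !orbT /=.
by have /andP[+ ->] := aW x y xW yW'; rewrite eq_sym => ->.
Qed.

Lemma isolated_union W W' x : x \in W -> apart W W' ->
  isolated e x W -> isolated e x (W :|: W').
Proof.
move=> xW aW iso y; rewrite inE => /orP[/iso //|yW'].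
by have /andP[] := aW x y xW yW'.
Qed.

Lemma depth_bound_union c W W' d d' : apart W W' ->
  depth_bound e c W d -> depth_bound e c W' d' ->
  depth_bound e c (W :|: W') (d + d').
Proof.
move=> + HW HW'; elim: HW => {W d}
  [|W x d xW _ IH _ IH'|W x d xW iso _ IH|W x d cc xW iso|W d d0 dd _ IH] aW.
- by rewrite set0U.
- have xU : x \in W :|: W' by rewrite inE xW.
  apply: (bound_branch xU).
    by rewrite setD1_union //; apply/IH/(apart_sub _ aW)/subD1set.
  rewrite link_union //; apply: bound_weaken (IH' _).
    by rewrite /= ; lia.
  by apply: apart_sub aW; apply: link_sub.
- have xU : x \in W :|: W' by rewrite inE xW.
  apply: (bound_isolated xU); first exact: isolated_union.
  by rewrite setD1_union //; apply/IH/(apart_sub _ aW)/subD1set.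
- apply: (@bound_cone _ _ _ _ x) => //; first by rewrite inE xW.
  exact: isolated_union.
by apply: bound_weaken (IH aW); rewrite leq_add2r.
Qed.

Lemma nonvanishing_union W W' k k' : apart W W' ->
  nonvanishing e W k -> nonvanishing e W' k' -> depth_bound e true W' k' ->
  nonvanishing e (W :|: W') (k + k').
Proof.
move=> + HW HW' HB; elim: HW => {W k} [|W x k xW _ IH ac|W x k xW _ IH ac] aW.
- by rewrite set0U.
- have xU : x \in W :|: W' by rewrite inE xW.
  apply: (nonvanishing_link xU).
    by rewrite link_union //; apply/IH/(apart_sub _ aW)/link_sub.
  rewrite setD1_union //; apply: (depth_bound_union _ ac HB).
  by apply: apart_sub aW; apply: subD1set.
have xU : x \in W :|: W' by rewrite inE xW.
apply: (nonvanishing_del xU).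
  by rewrite setD1_union //; apply/IH/(apart_sub _ aW)/subD1set.
rewrite link_union //; apply: (depth_bound_union _ ac HB).
by apply: apart_sub aW; apply: link_sub.
Qed.

Lemma copies_bound (F : nat -> {set V}) d c :
  (forall i j, (i < j < c)%N -> apart (F j) (F i)) ->
  (forall i, (i < c)%N -> depth_bound e false (F i) d) ->
  (forall i, (i < c)%N -> nonvanishing e (F i) d) ->
  depth_bound e false (\bigcup_(i < c) F i) (c * d) /\
  nonvanishing e (\bigcup_(i < c) F i) (c * d).
Proof.
elim: c => [|c IH] Fa Fd Fn.
  by rewrite big_ord0 mul0n; split; constructor.
have [||| Hd Hn] := IH.
- by move=> i j /andP[ij jc]; apply: Fa; rewrite ij ltnS ltnW.
- by move=> i ic; apply: Fd; rewrite ltnS ltnW.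
- by move=> i ic; apply: Fn; rewrite ltnS ltnW.
have aF : apart (F c) (\bigcup_(i < c) F i).
  move=> x y xF /bigcupP[i _]; apply: (Fa i c _ x y xF).
  by rewrite ltn_ord ltnSn.
rewrite big_ord_recr /= setUC mulSn; split.
  by apply: depth_bound_union => //; apply: Fd.
apply: nonvanishing_union => //; first exact: Fn.
exact: depth_bound_cone.
Qed.

End Unions.

Section Embedding.

Variables (V V' : finType) (e : rel V) (e' : rel V') (f : V' -> V).
Hypotheses (f_inj : injective f) (fe : forall x y, e (f x) (f y) = e' x y).
Implicit Types (W : {set V'}) (x : V').

Lemma imset_link W x : f @: link e' x W = link e (f x) (f @: W).
Proof.
apply/setP => y; apply/imsetP/idP => [[z + ->]|].
  by rewrite !inE fe (inj_eq f_inj) => /and3P[zW -> ->]; rewrite imset_f.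
rewrite !inE => /andP[/imsetP[z zW ->]].
by rewrite fe (inj_eq f_inj) => zx; exists z; rewrite // inE zW.
Qed.

Lemma imset_setD1 W x : f @: (W :\ x) = (f @: W) :\ f x.
Proof.
apply/setP => y; apply/imsetP/idP => [[z + ->]|].
  by rewrite !inE (inj_eq f_inj) => /andP[-> zW]; rewrite imset_f.
rewrite !inE => /andP[+ /imsetP[z zW yz]]; rewrite yz (inj_eq f_inj) => zx.
by exists z; rewrite // !inE zx.
Qed.

Lemma imset_isolated W x : isolated e' x W -> isolated e (f x) (f @: W).
Proof. by move=> iso y /imsetP[z zW ->]; rewrite fe; apply: iso. Qed.

Lemma depth_bound_imset c W d :
  depth_bound e' c W d -> depth_bound e c (f @: W) d.
Proof.
elim=> {W d} [|W x d xW _ IH _ IH'|W x d xW iso _ IH|W x d cc xW iso|W d d0 dd _ IH].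
- by rewrite imset0; apply: bound_empty.
- apply: (bound_branch (imset_f f xW)); first by rewrite -imset_setD1.
  by rewrite -imset_link.
- apply: (bound_isolated (imset_f f xW)); first exact: imset_isolated.
  by rewrite -imset_setD1.
- exact: (bound_cone _ cc (imset_f f xW) (imset_isolated iso)).
exact: bound_weaken IH.
Qed.

Lemma nonvanishing_imset W k :
  nonvanishing e' W k -> nonvanishing e (f @: W) k.
Proof.
elim=> {W k} [|W x k xW _ IH ac|W x k xW _ IH ac].
- by rewrite imset0; apply: nonvanishing_empty.
- apply: (nonvanishing_link (imset_f f xW)); first by rewrite -imset_link.
  by rewrite -imset_setD1; apply: depth_bound_imset.
apply: (nonvanishing_del (imset_f f xW)); first by rewrite -imset_setD1.
by rewrite -imset_link; apply: depth_bound_imset.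
Qed.

End Embedding.

(** * Ladders *)

Section Ladder.

Variables (m : nat) (tw : bool).
Hypothesis m_gt1 : (1 < m)%N.
Local Notation V := ('I_m * bool)%type.
Implicit Types (p q : V).

(** The rails are exchanged between the last and the first rung when tw holds:
    this is the Moebius ladder, otherwise the prism. *)
Definition next_on_rail p q :=
  if (p.1.+1 < m)%N then (q.1 == p.1.+1 :> nat) && (q.2 == p.2)
  else (q.1 == 0%N :> nat) && (q.2 == p.2 (+) tw).

Definition ladder p q :=
  [|| (p.1 == q.1 :> nat) && (p.2 != q.2), next_on_rail p q | next_on_rail q p].

(** In columns i and r only the vertices of rails b and c are left. *)
Definition strip (i : nat) (b : bool) (r : nat) (c : bool) : {set V} :=
  [set p : V | [&& (i <= p.1 <= r)%N, (p.1 == i :> nat) ==> (p.2 == b)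
    & (p.1 == r :> nat) ==> (p.2 == c)]].

Lemma V_eqE p q : (p == q) = (p.1 == q.1 :> nat) && (p.2 == q.2).
Proof. by case: p q => [a b] [a' b']; rewrite xpair_eqE -val_eqE. Qed.

Section Step.
Variables (i r : nat) (b c : bool) (p x : V).
Hypotheses (ir : (i.+1 < r)%N) (rm : (r < m)%N).
Hypothesis wrap : i = 0%N -> r.+1 = m -> c != b (+) tw.
Hypotheses (p1 : p.1 = i :> nat) (p2 : p.2 = b).
Hypotheses (x1 : x.1 = i.+1 :> nat) (x2 : x.2 = b).

Lemma strip_mem : (x \in strip i b r c) /\ (p \in strip i b r c :\ x).
Proof.
clear -ir p1 p2 x1 x2.
rewrite !inE V_eqE p1 p2 x1 x2.
by case: eqP; case: eqP; case: eqP; case: eqP; rewrite ?eqxx /=; lia.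
Qed.

Lemma strip_link : link ladder x (strip i b r c) = strip i.+2 (~~ b) r c.
Proof.
clear -tw ir rm wrap x1 x2.
apply/setP => -[j d]; rewrite !inE V_eqE /ladder /next_on_rail /= x1 x2.
have := ltn_ord j; move: (nat_of_ord j) => {}j jm.
by case: d b c tw wrap => [] [] [] [] /= w; repeat case: ifP => /=; lia.
Qed.

Lemma strip_del : strip i b r c :\ x :\ p = strip i.+1 (~~ b) r c.
Proof.
clear -ir p1 p2 x1 x2.
apply/setP => -[j d]; rewrite !inE !V_eqE /= x1 x2 p1 p2.
move: (nat_of_ord j) => {}j.
by case: b d c => [] [] [] /=; lia.
Qed.

Lemma strip_pendant : isolated ladder p (strip i b r c :\ x).
Proof.
clear -ir rm wrap p1 p2 x1 x2.
move=> [j d]; rewrite !inE V_eqE /ladder /next_on_rail /= x1 x2 p1 p2.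
have := ltn_ord j; move: (nat_of_ord j) => {}j jm.
by case: d b c tw wrap => [] [] [] [] /= w; repeat case: ifP => /=; lia.
Qed.

End Step.

(** The first of the columns 1 to r is full, in the last only rail c is left. *)
Definition half_strip (r : nat) (c : bool) : {set V} :=
  [set p : V | (1 <= p.1 <= r)%N && ((p.1 == r :> nat) ==> (p.2 == c))].

Section HalfStep.
Variables (r : nat) (c : bool) (p x : V).
Hypotheses (rm : (r.+3 < m)%N).
Hypotheses (p1 : p.1 = r.+2 :> nat) (p2 : p.2 = c).
Hypotheses (x1 : x.1 = r.+1 :> nat) (x2 : x.2 = c).

Lemma half_strip_mem : (x \in half_strip r.+2 c) /\ (p \in half_strip r.+2 c :\ x).
Proof.
clear -p1 p2 x1 x2.
rewrite !inE V_eqE p1 p2 x1 x2.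
by case: eqP; case: eqP; case: eqP; rewrite ?eqxx /=; lia.
Qed.

Lemma half_strip_link :
  link ladder x (half_strip r.+2 c) = half_strip r (~~ c).
Proof.
clear -tw rm x1 x2.
apply/setP => -[j d]; rewrite !inE V_eqE /ladder /next_on_rail /= x1 x2.
have := ltn_ord j; move: (nat_of_ord j) => {}j jm.
by case: d c tw => [] [] [] /=; repeat case: ifP => /=; lia.
Qed.

Lemma half_strip_del :
  half_strip r.+2 c :\ x :\ p = half_strip r.+1 (~~ c).
Proof.
clear -p1 p2 x1 x2.
apply/setP => -[j d]; rewrite !inE !V_eqE /= x1 x2 p1 p2.
move: (nat_of_ord j) => {}j.
by case: d c => [] [] /=; lia.
Qed.

Lemma half_strip_pendant : isolated ladder p (half_strip r.+2 c :\ x).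
Proof.
clear -tw rm p1 p2 x1 x2.
move=> [j d]; rewrite !inE V_eqE /ladder /next_on_rail /= x1 x2 p1 p2.
have := ltn_ord j; move: (nat_of_ord j) => {}j jm.
by case: d c tw => [] [] [] /=; repeat case: ifP => /=; lia.
Qed.

End HalfStep.

(* x is removed first, then y, which lies diagonally across the closing edge of
   the ladder.  Removing x and the other vertex of its rung instead would leave
   a full ladder, whose depth is too small for some m. *)
Section Cut.
Variables (x y : V).
Hypotheses (x1 : x.1 = 0%N :> nat) (x2 : x.2 = false).
Hypotheses (y1 : y.1.+1 = m :> nat) (y2 : y.2 = ~~ tw).

Lemma cut_mem : y \in [set: V] :\ x.
Proof.
clear -m_gt1 x1 y1. by rewrite !inE V_eqE x1; case: eqP => //=; lia. Qed.

Lemma cut_link : link ladder x [set: V] = strip 1 true m.-1 (~~ tw).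
Proof.
clear -tw m_gt1 x1 x2.
apply/setP => -[j d]; rewrite !inE V_eqE /ladder /next_on_rail /= x1 x2.
have := ltn_ord j; move: (nat_of_ord j) => {}j jm.
by case: d tw => [] [] /=; repeat case: ifP => /=; lia.
Qed.

Lemma cut_del_link : link ladder y ([set: V] :\ x) = half_strip m.-2 tw.
Proof.
clear -m_gt1 x1 x2 y1 y2.
apply/setP => -[j d]; rewrite !inE !V_eqE /ladder /next_on_rail /= x1 x2 y2.
have := ltn_ord j; move: (nat_of_ord j) (nat_of_ord y.1) y1 => {}j k km jm.
by case: d tw => [] [] /=; repeat case: ifP => /=; lia.
Qed.

Lemma cut_del_del : [set: V] :\ x :\ y = strip 0 true m.-1 tw.
Proof.
clear -x1 x2 y1 y2.
apply/setP => -[j d]; rewrite !inE !V_eqE /ladder /next_on_rail /= x1 x2 y2.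
have := ltn_ord j; move: (nat_of_ord j) (nat_of_ord y.1) y1 => {}j k km jm.
by case: d tw => [] [] /=; lia.
Qed.

End Cut.

End Ladder.

Section LadderDepth.

Variables (m : nat) (tw : bool).
Hypothesis m_gt1 : (1 < m)%N.
Local Notation V := ('I_m * bool)%type.
Local Notation ladder := (@ladder m tw).
Local Notation strip := (@strip m).
Local Notation half_strip := (@half_strip m).
Implicit Types (p q x : V).

(** When a strip goes all the way round, its two end vertices must not be
    adjacent across the closing edge. *)
Definition admissible i b r c := i = 0%N -> r.+1 = m -> c != b (+) tw.

Lemma column j b : (j < m)%N -> exists x : V, x.1 = j :> nat /\ x.2 = b.
Proof. by move=> jm; exists (Ordinal jm, b). Qed.

Lemma ladder_irr x : ~~ ladder x x.
Proof.
rewrite /ladder /next_on_rail eqxx /=; have := ltn_ord x.1.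
by move: m_gt1; case: x.2; case: tw; case: ifP => /=; lia.
Qed.

Lemma isolated1 x : isolated ladder x [set x].
Proof. by move=> y /set1P ->; apply: ladder_irr. Qed.

Lemma depth_bound1 x : depth_bound ladder false [set x] 1.
Proof.
apply: (bound_isolated (set11 x) (@isolated1 x)).
by rewrite setDv; apply: bound_empty.
Qed.

Lemma strip0 i b c x : (i < m)%N -> x.1 = i :> nat -> x.2 = b ->
  strip i b i c = if b == c then [set x] else set0.
Proof.
move=> im x1 x2; case: eqP => bc; apply/setP => -[j d].
  rewrite !inE V_eqE /= x1 x2.
  by case: b c d bc {x2} => [] [] [] //= _; lia.
rewrite !inE /=; by case: b c d bc {x2} => [] [] [] //= _; lia.
Qed.

Lemma strip1 i b c p q : p.1 = i :> nat -> p.2 = b ->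
  q.1 = i.+1 :> nat -> q.2 = c -> strip i b i.+1 c = [set p; q].
Proof.
move=> p1 p2 q1 q2; apply/setP => -[j d]; rewrite !inE !V_eqE /= p1 p2 q1 q2.
by case: b c d {p2 q2} => [] [] [] /=; lia.
Qed.

Lemma strip1_edge i b c p q : admissible i b i.+1 c -> p.1 = i :> nat -> p.2 = b ->
  q.1 = i.+1 :> nat -> q.2 = c -> ladder p q = (b == c).
Proof.
move=> w p1 p2 q1 q2; rewrite /ladder /next_on_rail p1 p2 q1 q2.
have := ltn_ord q.1; rewrite q1 /admissible in w * => qm.
by case: b c tw w {p2 q2} => [] [] [] /= w; case: ifP => /=; case: ifP => /=; lia.
Qed.

Lemma pair_del p q : p != q -> [set p; q] :\ p = [set q].
Proof.
move=> pq; apply/setP => y; rewrite !inE; case: (eqVneq y p) => [->|] //=.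
by rewrite (negbTE pq).
Qed.

Lemma pair_link p q : ladder p q -> link ladder p [set p; q] = set0.
Proof.
move=> pq; apply/setP => y; rewrite !inE; apply/negP.
by case/and3P=> /orP[] /eqP ->; rewrite ?eqxx ?pq.
Qed.

Lemma pair_isolated p q : ~~ ladder p q -> isolated ladder p [set p; q].
Proof. by move=> pq y /set2P[] -> //; apply: ladder_irr. Qed.

(** Here l is the distance of the end columns, and same tells whether the two
    pendant vertices lie on the same rail. *)
Definition strip_depth l same :=
  (if same then (l.+1 %/ 4).*2.+1 else (l.+3 %/ 4).*2)%N.

Definition strip_contractible l same :=
  (if same then (l %% 4 == 0) || (l %% 4 == 3)
   else (l %% 4 == 1) || (l %% 4 == 2))%N.

(** Branching at the neighbour x of the pendant vertex of a strip leaves the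
    pendant vertex isolated in the deletion; both remainders are shorter strips
    with the pendant vertex on the other rail. *)
Lemma strip_bound l i b c : (i + l < m)%N -> admissible i b (i + l) c ->
  depth_bound ladder false (strip i b (i + l) c) (strip_depth l (b == c)).
Proof.
elim/ltn_ind: l i b => -[|[|l]] IH i b; rewrite ?addn0 ?addn1 => rm w.
- have [x [x1 x2]] := column b rm.
  rewrite (strip0 c rm x1 x2); case: eqP => _; first exact: depth_bound1.
  exact: bound_empty.
- have [q [q1 q2]] := column c rm; have [p [p1 p2]] := column b (ltnW rm).
  have pq : p != q by rewrite V_eqE p1 q1; lia.
  rewrite (strip1 p1 p2 q1 q2); have := strip1_edge w p1 p2 q1 q2.
  case: eqP => _ pqe.
    apply: (@bound_branch _ _ _ _ p); first by rewrite !inE eqxx.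
      by rewrite pair_del //; apply: depth_bound1.
    by rewrite pair_link //; apply: bound_empty.
  apply: (@bound_isolated _ _ _ _ p); first by rewrite !inE eqxx.
    by apply: pair_isolated; rewrite pqe.
  by rewrite pair_del //; apply: depth_bound1.
have ir : (i.+1 < i + l.+2)%N by lia.
have [x [x1 x2]] := column b (ltn_trans ir rm).
have [p [p1 p2]] := column b (ltnW (ltn_trans ir rm)).
have [xW pW] := strip_mem c ir p1 p2 x1 x2.
apply: (bound_branch xW).
  apply: bound_weaken (bound_isolated pW (strip_pendant ir rm w p1 p2 x1 x2) _);
    last first.
    rewrite (strip_del c ir p1 p2 x1 x2).
    have := IH l.+1 _ i.+1 (~~ b); rewrite addSnnS; apply=> //.
  by rewrite /strip_depth; case: b c {IH w p2 x2 xW pW} => [] [] /=; lia.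
rewrite (strip_link ir rm w x1 x2).
apply: bound_weaken; last first.
  by have := IH l _ i.+2 (~~ b); rewrite !addSnnS; apply.
by rewrite /strip_depth; case: b c {IH w p2 x2 xW pW} => [] [] /=; lia.
Qed.

(** Deleting x leaves a cone, so the cohomology of a strip is that of the link
    of x, two columns shorter, moved up by one; it is decided by the strips
    with at most two columns. *)
Lemma strip_acyclic l i b c d : (i + l < m)%N -> admissible i b (i + l) c ->
  strip_contractible l (b == c) ->
  depth_bound ladder true (strip i b (i + l) c) d.
Proof.
elim/ltn_ind: l i b d => -[|[|l]] IH i b d; rewrite ?addn0 ?addn1 => rm w ac.
- have [x [x1 x2]] := column b rm.
  rewrite (strip0 c rm x1 x2); move: ac; case: eqP => // _ _.
  exact: (bound_cone _ _ (set11 x) (@isolated1 x)).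
- have [q [q1 q2]] := column c rm; have [p [p1 p2]] := column b (ltnW rm).
  rewrite (strip1 p1 p2 q1 q2); have := strip1_edge w p1 p2 q1 q2.
  move: ac; case: eqP => // _ _ pqe.
  apply: (@bound_cone _ _ _ _ p) => //; first by rewrite !inE eqxx.
  by apply: pair_isolated; rewrite pqe.
have ir : (i.+1 < i + l.+2)%N by lia.
have [x [x1 x2]] := column b (ltn_trans ir rm).
have [p [p1 p2]] := column b (ltnW (ltn_trans ir rm)).
have [xW pW] := strip_mem c ir p1 p2 x1 x2.
apply: (bound_branch xW).
  exact: (bound_cone _ _ pW (strip_pendant ir rm w p1 p2 x1 x2)).
rewrite (strip_link ir rm w x1 x2).
have := IH l _ i.+2 (~~ b); rewrite !addSnnS; apply=> //.
by move: ac; rewrite /strip_contractible; clear; case: b c => [] [] /=; lia.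
Qed.

Lemma strip_nonvanishing l i b c : (i + l < m)%N -> admissible i b (i + l) c ->
  ~~ strip_contractible l (b == c) ->
  nonvanishing ladder (strip i b (i + l) c) (uphalf l).
Proof.
elim/ltn_ind: l i b => -[|[|l]] IH i b; rewrite ?addn0 ?addn1 => rm w ac.
- have [x [x1 x2]] := column b rm.
  rewrite (strip0 c rm x1 x2); move: ac; case: eqP => // _ _.
  exact: nonvanishing_empty.
- have [q [q1 q2]] := column c rm; have [p [p1 p2]] := column b (ltnW rm).
  have pq : p != q by rewrite V_eqE p1 q1; lia.
  rewrite (strip1 p1 p2 q1 q2); have := strip1_edge w p1 p2 q1 q2.
  move: ac; case: eqP => // _ _ pqe.
  apply: (@nonvanishing_link _ _ _ p); first by rewrite !inE eqxx.
    by rewrite pair_link //; apply: nonvanishing_empty.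
  rewrite pair_del //; exact: (bound_cone _ _ (set11 q) (@isolated1 q)).
have ir : (i.+1 < i + l.+2)%N by lia.
have [x [x1 x2]] := column b (ltn_trans ir rm).
have [p [p1 p2]] := column b (ltnW (ltn_trans ir rm)).
have [xW pW] := strip_mem c ir p1 p2 x1 x2.
apply: (nonvanishing_link xW); last first.
  exact: (bound_cone _ _ pW (strip_pendant ir rm w p1 p2 x1 x2)).
rewrite (strip_link ir rm w x1 x2).
have := IH l _ i.+2 (~~ b); rewrite !addSnnS; apply=> //.
by move: ac; rewrite /strip_contractible; clear; case: b c => [] [] /=; lia.
Qed.

Lemma half_strip0 c : half_strip 0 c = set0.
Proof. by apply/setP => -[j d]; rewrite !inE /=; lia. Qed.

Lemma half_strip1 c x : x.1 = 1%N :> nat -> x.2 = c -> half_strip 1 c = [set x].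
Proof.
move=> x1 x2; apply/setP => -[j d]; rewrite !inE V_eqE /= x1 x2.
by case: c d {x2} => [] [] /=; lia.
Qed.

Lemma half_strip_bound r c : (r.+1 < m)%N ->
  depth_bound ladder false (half_strip r c) r.+1./2.
Proof.
elim/ltn_ind: r c => -[|[|r]] IH c rm.
- by rewrite half_strip0; apply: bound_empty.
- have [x [x1 x2]] := column c (ltnW rm).
  by rewrite (half_strip1 x1 x2); apply: depth_bound1.
have [p [p1 p2]] := column c (ltnW rm).
have [x [x1 x2]] := column c (ltnW (ltnW rm)).
have [xW pW] := half_strip_mem p1 p2 x1 x2.
apply: (bound_branch xW).
  apply: bound_weaken (bound_isolated pW (half_strip_pendant tw rm p1 p2 x1 x2) _);
    last first.
    by rewrite (half_strip_del p1 p2 x1 x2); apply: IH => //; lia.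
  by rewrite /=; lia.
rewrite (half_strip_link tw rm x1 x2).
by apply: bound_weaken; last (apply: IH => //; lia); rewrite /=; lia.
Qed.

Lemma half_strip_acyclic r c d : (r.+1 < m)%N -> odd r ->
  depth_bound ladder true (half_strip r c) d.
Proof.
elim/ltn_ind: r c d => -[|[|r]] IH c d rm //= ro.
  have [x [x1 x2]] := column c (ltnW rm).
  rewrite (half_strip1 x1 x2).
  exact: (bound_cone _ _ (set11 x) (@isolated1 x)).
have [p [p1 p2]] := column c (ltnW rm).
have [x [x1 x2]] := column c (ltnW (ltnW rm)).
have [xW pW] := half_strip_mem p1 p2 x1 x2.
apply: (bound_branch xW).
  exact: (bound_cone _ _ pW (half_strip_pendant tw rm p1 p2 x1 x2)).
rewrite (half_strip_link tw rm x1 x2).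
by apply: IH => //; lia.
Qed.

Lemma half_strip_nonvanishing r c : (r.+1 < m)%N -> ~~ odd r ->
  nonvanishing ladder (half_strip r c) r./2.
Proof.
elim/ltn_ind: r c => -[|[|r]] IH c rm //= re.
  by rewrite half_strip0; apply: nonvanishing_empty.
have [p [p1 p2]] := column c (ltnW rm).
have [x [x1 x2]] := column c (ltnW (ltnW rm)).
have [xW pW] := half_strip_mem p1 p2 x1 x2.
apply: (nonvanishing_link xW).
  rewrite (half_strip_link tw rm x1 x2).
  by apply: IH => //; lia.
exact: (bound_cone _ _ pW (half_strip_pendant tw rm p1 p2 x1 x2)).
Qed.

(** The second value is that of the prisms with an odd number of rungs. *)
Definition ladder_depth :=
  (if tw then (m %/ 4).*2 + (m %% 4 != 0) else (m.+1 %/ 4).*2)%N.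

(** The class comes from one of the three strips obtained by cutting at x and y;
    which one depends on m modulo 4 and on the twist. *)
Lemma ladder_depth_exact : tw || odd m ->
  depth_bound ladder false [set: V] ladder_depth /\
  nonvanishing ladder [set: V] ladder_depth.
Proof.
move=> twm.
have [x [x1 x2]] := column false (ltnW m_gt1).
have [y [y1 y2]] := column (~~ tw) (ltac:(lia) : (m.-1 < m)%N).
have {}y1 : y.1.+1 = m by rewrite y1; lia.
have yW := cut_mem m_gt1 x1 y1.
have E1 : (1 + m.-2 = m.-1)%N by lia.
have E0 : (0 + m.-1 = m.-1)%N by lia.
have w1 : admissible 1 true (1 + m.-2) (~~ tw) by [].
have w0 : admissible 0 true (0 + m.-1) tw by move=> _ _; case: tw.
have l1 : (1 + m.-2 < m)%N by lia.
have l0 : (0 + m.-1 < m)%N by lia.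
have lh : (m.-2.+1 < m)%N by lia.
have b1 := strip_bound l1 w1; have b0 := strip_bound l0 w0.
have bh := half_strip_bound tw lh.
have a1 d := strip_acyclic d l1 w1; have a0 d := strip_acyclic d l0 w0.
have ah d := half_strip_acyclic tw d lh.
have n1 := strip_nonvanishing l1 w1; have n0 := strip_nonvanishing l0 w0.
have nh := half_strip_nonvanishing tw lh.
rewrite E1 -(cut_link tw m_gt1 x1 x2) in b1 a1 n1.
rewrite E0 -(cut_del_del x1 x2 y1 y2) in b0 a0 n0.
rewrite -(cut_del_link m_gt1 x1 x2 y1 y2) in bh ah nh.
clear E1 E0 w1 w0 l1 l0 lh.
have Bx : depth_bound ladder false ([set: V] :\ x) ladder_depth.
  apply: (bound_branch yW).
    apply: bound_weaken b0; rewrite /ladder_depth /strip_depth.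
    by move: m_gt1 twm; clear; case: tw => /=; lia.
  apply: bound_weaken bh; rewrite /ladder_depth.
  by move: m_gt1 twm; clear; case: tw => /=; lia.
have xV : x \in [set: V] by rewrite inE.
split.
  apply: (bound_branch xV Bx); apply: bound_weaken b1.
  rewrite /ladder_depth /strip_depth.
  by move: m_gt1 twm; clear; case: tw => /=; lia.
have [c1|nc1] := boolP (strip_contractible m.-2 (true == ~~ tw)); last first.
  have DE : ladder_depth = (uphalf m.-2).+1.
    move: m_gt1 twm nc1; rewrite /ladder_depth /strip_contractible; clear.
    by case: tw => /=; lia.
  rewrite DE; apply: (nonvanishing_link xV (n1 nc1)).
  by rewrite -DE; apply: depth_bound_cone.
apply: (nonvanishing_del xV); last exact: a1.
have [c0|nc0] := boolP (strip_contractible m.-1 (true == tw)); last first.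
  have DE : ladder_depth = uphalf m.-1.
    move: m_gt1 twm c1 nc0; rewrite /ladder_depth /strip_contractible; clear.
    by case: tw => /=; lia.
  rewrite DE; apply: (nonvanishing_del yW (n0 nc0)); apply: ah.
  move: m_gt1 twm c1 nc0; rewrite /strip_contractible; clear.
  by case: tw => /=; lia.
have DE : ladder_depth = (m.-2./2).+1.
  move: m_gt1 twm c1 c0; rewrite /ladder_depth /strip_contractible; clear.
  by case: tw => /=; lia.
rewrite DE; apply: (nonvanishing_link yW); last exact: a0.
apply: nh; move: m_gt1 twm c1 c0; rewrite /strip_contractible; clear.
by case: tw => /=; lia.
Qed.

End LadderDepth.

(** * Cubic circulant graphs as unions of ladders *)

Section Adjacency.

Variables (n a : nat).
Hypotheses (a_gt0 : (0 < a)%N) (a_lt_n : (a < n)%N).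

Lemma modn_small2 x : (x < 4 * n)%N ->
  (x %% (2 * n) = if x < 2 * n then x else x - 2 * n)%N.
Proof.
move=> x4; case: ltnP => xn; first exact: modn_small.
by rewrite -{1}(subnK xn) modnDr modn_small //; lia.
Qed.

Lemma circulant_adjE (i j : 'I_(2 * n)) : circulant (2 * n) [:: a; n] i j =
  [|| (i + n == j %[mod 2 * n])%N, (i + a == j %[mod 2 * n])%N
    | (j + a == i %[mod 2 * n])%N].
Proof.
rewrite /= /circulant_adj !inE -val_eqE /=.
have := ltn_ord i; have := ltn_ord j.
move: (nat_of_ord i) (nat_of_ord j) => {}i {}j jn iN.
have -> : `|i - j|%N = (maxn i j - minn i j)%N by lia.
rewrite !modn_small2; try lia.
by repeat case: ifP; lia.
Qed.

End Adjacency.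

Section Components.

Variables (n a m h : nat) (tw : bool).
Hypotheses (m_gt1 : (1 < m)%N) (mh : (h * m = n)%N) (h_a : (h %| a)%N).
Hypotheses (a_gt0 : (0 < a)%N) (a_lt_n : (a < n)%N) (tw_m : tw || odd m).
(* Going m times by a closes up modulo 2n, with an additional n if tw holds,
   and these are all the relations between a and n. *)
Hypothesis steps : forall d c, (2 * n %| d * a + c * n)%N =
  (m %| d)%N && ~~ odd (tw * (d %/ m) + c).

Let n_gt0 : (0 < n)%N := leq_ltn_trans (leq0n a) a_lt_n.
Let n2_gt0 : (0 < 2 * n)%N. Proof. by rewrite muln_gt0 n_gt0. Qed.

Lemma steps_eq s c s' c' : (s <= s')%N ->
  (s * a + c * n == s' * a + c' * n %[mod 2 * n])%N =
  (m %| s' - s)%N && ~~ odd (tw * ((s' - s) %/ m) + (c + c')).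
Proof.
move=> ss'; rewrite -steps.
rewrite -(modnMDl c (s' * a + c' * n)%N (2 * n)%N) eq_sym eqn_mod_dvd.
  congr (_ %| _)%N; have E : (s' = s + (s' - s))%N by lia.
  by move: (s' - s)%N E => d ->; lia.
have : (s * a <= s' * a)%N by rewrite leq_mul2r ss' orbT.
by move: (s * a)%N (s' * a)%N => x y; lia.
Qed.

Definition vertex_code (r : nat) (p : 'I_m * bool) : nat :=
  (r + (p.1 * a + p.2 * n))%N.

Definition vertex r p : 'I_(2 * n) := Ordinal (ltn_pmod (vertex_code r p) n2_gt0).

Lemma dvdn_small x : (x < m)%N -> (m %| x)%N = (x == 0%N).
Proof.
move=> xm; apply/idP/eqP => [|->]; last exact: dvdn0.
by case: x xm => // x xm /dvdn_leq => /(_ isT); rewrite leqNgt xm.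
Qed.

(** The value s = m stands for the column reached from the last one, which is
    column 0 again. *)
Lemma steps_small s c s' c' : (s <= m)%N -> (s' < m)%N ->
  (s * a + c * n == s' * a + c' * n %[mod 2 * n])%N =
  if (s == m) then (s' == 0%N) && ~~ odd (tw + (c + c'))
  else (s == s') && ~~ odd (c + c').
Proof.
move=> sm s'm; case: (leqP s s') => [ss'|ss'].
  rewrite steps_eq // (dvdn_small (leq_ltn_trans (leq_subr _ _) s'm)).
  have -> : (s == m) = false by lia.
  have -> : (s' - s == 0)%N = (s == s') by lia.
  by case: eqP => // ->; rewrite subnn div0n muln0.
rewrite eq_sym steps_eq ?(ltnW ss') // [(c' + c)%N]addnC.
have [sE|sN] := eqVneq s m; last first.
  have sd : (s - s' < m)%N by lia.
  rewrite (dvdn_small sd); have -> : (s - s' == 0)%N = (s == s') by lia.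
  by have -> : (s == s') = false by lia.
rewrite sE; case: (posnP s') => [->|s'0].
  by rewrite subn0 dvdnn divnn (ltnW m_gt1) muln1.
have sd : (m - s' < m)%N by lia.
by rewrite (dvdn_small sd); have -> : (m - s' == 0)%N = false by lia.
Qed.

Lemma vertex_ladder r p q :
  circulant (2 * n) [:: a; n] (vertex r p) (vertex r q) = ladder tw p q.
Proof.
case: p q => [j b] [j' b'].
rewrite circulant_adjE //= !modnDml !modn_mod /vertex_code /= -!addnA !eqn_modDl.
have -> : (j * a + (b * n + n) = j * a + (b + 1) * n)%N by lia.
have -> : (j * a + (b * n + a) = j.+1 * a + b * n)%N by lia.
have -> : (j' * a + (b' * n + a) = j'.+1 * a + b' * n)%N by lia.
have jm := ltn_ord j; have jm' := ltn_ord j'.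
rewrite !steps_small ?(ltnW jm) // /ladder /next_on_rail /=.
move: (nat_of_ord j) (nat_of_ord j') jm jm' => {}j {}j' jm jm'.
clear -jm jm'; case: b b' tw => [] [] [] /=; repeat case: ifP => /=; lia.
Qed.

Lemma vertex_inj r : injective (vertex r).
Proof.
move=> [j b] [j' b'] /(congr1 val) /= /eqP.
rewrite eqn_modDl /= steps_small //; last exact: ltnW.
have -> : (nat_of_ord j == m) = false by have := ltn_ord j; lia.
move=> H; apply/eqP; rewrite xpair_eqE -val_eqE /=; move: H.
by case: eqP => //= _; case: b b' => [] [].
Qed.

(** All steps are multiples of h, so the components are told apart by residues
    modulo h. *)
Lemma vertex_apart_mod r r' x y : (r < r' < h)%N ->
  (h %| x)%N -> (h %| y)%N -> (r + x == r' + y %[mod 2 * n])%N = false.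
Proof.
move=> rr' hx hy; apply/negP => E.
have h2n : (h %| 2 * n)%N by rewrite -mh dvdn_mull // dvdn_mulr.
have : (r + x == r' + y %[mod h])%N.
  by have /eqP := congr1 (modn^~ h) (eqP E); rewrite !modn_dvdm.
case/andP: rr' => rr' r'h.
case/dvdnP: hx => k ->; case/dvdnP: hy => k' ->.
rewrite ![(_ + _ * h)%N]addnC !modnMDl !modn_small //; last exact: ltn_trans r'h.
by move=> /eqP rE; rewrite rE ltnn in rr'.
Qed.

Let h_n : (h %| n)%N. Proof. by rewrite -mh dvdn_mulr. Qed.

Let h_code k c : (h %| k * a + c * n)%N.
Proof. by rewrite dvdn_add // dvdn_mull. Qed.

Lemma vertex_apart r r' p q : (r < r' < h)%N ->
  (vertex r' p != vertex r q) &&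
  ~~ circulant (2 * n) [:: a; n] (vertex r' p) (vertex r q).
Proof.
move=> rr'; rewrite circulant_adjE // -val_eqE /= !modnDml !modn_mod.
rewrite /vertex_code -!addnA ![_ == (r + _) %[mod _]]eq_sym.
rewrite !vertex_apart_mod // ?h_code // ?dvdn_add //.
all: by rewrite ?dvdn_mull // ?h_a ?h_n // dvdn_add // ?dvdn_mull.
Qed.

Lemma vertex_cover : \bigcup_(r < h) (vertex r @: setT) = setT.
Proof.
pose F (rp : 'I_h * ('I_m * bool)) := vertex rp.1 rp.2.
have Finj : injective F.
  move=> [r p] [r' p']; rewrite /F /= => E.
  case: (ltngtP r r') => [lt|lt|/val_inj rr'].
  - have /andP[] := @vertex_apart r r' p' p (introT andP (conj lt (ltn_ord r'))).
    by rewrite E eqxx.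
  - have /andP[] := @vertex_apart r' r p p' (introT andP (conj lt (ltn_ord r))).
    by rewrite E eqxx.
  by move: E; rewrite rr' => /vertex_inj ->.
apply/setP => i; rewrite !inE; apply/bigcupP.
have cardF : (#|'I_(2 * n)| <= #|{: 'I_h * ('I_m * bool)}|)%N.
  by rewrite !card_prod !card_ord card_bool -mh; lia.
have /codomP[[r p] ->] := inj_card_onto Finj cardF i.
by exists r => //; exact: (imset_f (vertex r) (in_setT p)).
Qed.

Lemma circulant_depth (d := ladder_depth m tw) :
  depth_bound (circulant (2 * n) [:: a; n]) false setT (h * d) /\
  nonvanishing (circulant (2 * n) [:: a; n]) setT (h * d).
Proof.
have [Hd Hn] := ladder_depth_exact m_gt1 tw_m.
rewrite -vertex_cover.
apply: (copies_bound (F := fun r => vertex r @: setT)).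
- move=> i j ij x y /imsetP[p _ ->] /imsetP[q _ ->].
  exact: vertex_apart.
- by move=> r _; apply: (depth_bound_imset (@vertex_inj r) (vertex_ladder r) Hd).
by move=> r _; apply: (nonvanishing_imset (@vertex_inj r) (vertex_ladder r) Hn).
Qed.

End Components.

(** * The two families of cubic circulant graphs *)

(** As a/t is odd, m steps of size a lead from a vertex to its opposite. *)
Lemma steps_even n a m t : (0 < t)%N -> (0 < m)%N -> n = (m * t)%N ->
  gcdn (2 * n) a = t -> forall d c,
  (2 * n %| d * a + c * n)%N = (m %| d)%N && ~~ odd (true * (d %/ m) + c).
Proof.
move=> t0 m0 nE tE d c; have /dvdnP[a' aE] : (t %| a)%N by rewrite -tE dvdn_gcdr.
have co : coprime (2 * m) a'.
  move: tE; rewrite nE aE mulnA -muln_gcdl => /eqP.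
  by rewrite -{2}[t]mul1n eqn_pmul2r.
have a'o : odd a' by move: co; rewrite coprimeMl coprime2n => /andP[].
have com : coprime m a' by move: co; rewrite coprimeMl => /andP[].
have -> : (d * a + c * n = (d * a' + c * m) * t)%N by rewrite nE aE; lia.
rewrite nE mulnA dvdn_pmul2r // mul1n.
have [/dvdnP[k ->]|nd] := boolP (m %| d)%N.
  have -> : (k * m * a' + c * m = (k * a' + c) * m)%N by lia.
  rewrite dvdn_pmul2r // dvdn2 mulnK // !oddD oddM a'o andbT.
  by [].
apply: contraNF nd => /(dvdn_trans (dvdn_mull 2 (dvdnn m))).
by rewrite (dvdn_addl _ (dvdn_mull c (dvdnn m))) Gauss_dvdl.
Qed.

(** As a/h is even and n/h is odd, no multiple of a is congruent to n. *)
Lemma steps_odd n a m h : (0 < h)%N -> odd m -> n = (h * m)%N ->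
  gcdn (2 * n) a = h.*2 -> forall d c,
  (2 * n %| d * a + c * n)%N = (m %| d)%N && ~~ odd (false * (d %/ m) + c).
Proof.
move=> h0 mo nE tE d c.
have /dvdnP[a' aE] : (h.*2 %| a)%N by rewrite -tE dvdn_gcdr.
have m0 : (0 < m)%N by exact: odd_gt0.
have com : coprime m a'.
  move: tE; rewrite nE aE (_ : 2 * (h * m) = m * h.*2)%N; last by lia.
  rewrite -muln_gcdl => /eqP.
  by rewrite -{2}[h.*2]mul1n eqn_pmul2r ?double_gt0.
have com2 : coprime m (2 * a') by rewrite coprimeMr com coprimen2 mo.
have -> : (d * a + c * n = (d * (2 * a') + c * m) * h)%N by rewrite nE aE; lia.
rewrite nE (_ : 2 * (h * m) = 2 * m * h)%N; last by lia.
rewrite dvdn_pmul2r // mul0n add0n.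
have [/dvdnP[k ->]|nd] := boolP (m %| d)%N.
  have -> : (k * m * (2 * a') + c * m = (2 * (k * a') + c) * m)%N by lia.
  by rewrite dvdn_pmul2r // dvdn2 oddD oddM.
apply: contraNF nd => /(dvdn_trans (dvdn_mull 2 (dvdnn m))).
by rewrite (dvdn_addl _ (dvdn_mull c (dvdnn m))) Gauss_dvdl.
Qed.

Lemma ceil_half k : Num.ceil (k%:R / 2 : rat) = (uphalf k)%:Z.
Proof.
apply: Num.Theory.ceil_def.
have -> : k%:R = (odd k)%:R + 2 * (k./2)%:R :> rat.
  by rewrite -{1}(odd_double_half k) natrD -mul2n natrM.
rewrite uphalf_half intrB -!pmulrn natrD.
by case: (odd k) => /=; apply/andP; split; lra.
Qed.

Theorem corollary4p10 (K : fieldType) (n a : nat) (n_ge2 : (2 <= n)%N)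
    (a_ge1 : (1 <= a)%N) (a_lt_n : (a < n)%N) :
  let t := gcdn (2 * n) a in
  let nQ := n%:R : rat in
  let tQ := t%:R : rat in
  let I := edge_ideal (K := K) (circulant (2 * n) [:: a; n]) in
  exists2 p : nat, pdim_quot I p &

    (~~ odd (2 * n %/ t) ->
       p%:R = if n %/ t == 1 %[mod 4]
              then 2 * nQ - (Num.ceil (nQ / (2 * tQ)))%:~R * tQ
              else 2 * nQ - (Num.ceil ((nQ - tQ) / (2 * tQ)))%:~R * tQ)
    /\

    (odd (2 * n %/ t) ->
       (2 * n %/ t = 1 %[mod 4] ->
          p%:R = 2 * nQ
                 - (Num.ceil ((2 * nQ - tQ) / (2 * tQ)))%:~R * (tQ / 2))
       /\
       (2 * n %/ t = 3 %[mod 4] ->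
          p%:R = 2 * nQ - (Num.ceil (nQ / tQ))%:~R * (tQ / 2))).
Proof.
move=> t nQ tQ I.
have t0 : (0 < t)%N by rewrite gcdn_gt0 a_ge1 orbT.
have ta : (t %| a)%N by apply: dvdn_gcdr.
have t2n : (t %| 2 * n)%N by apply: dvdn_gcdl.
have tle : (t <= a)%N by apply: dvdn_leq.
have tQ0 : tQ != 0 by rewrite Num.Theory.pnatr_eq0 -lt0n.
have [odd_q|even_q] := boolP (odd (2 * n %/ t)).
  set m := (2 * n %/ t)%N in odd_q *.
  have mt : (m * t = 2 * n)%N by rewrite divnK.
  have [h th] : exists h, t = h.*2.
    exists t./2; have := congr1 odd mt; rewrite oddM odd_q oddM /= => to.
    by rewrite -[LHS]odd_double_half to.
  have h0 : (0 < h)%N by lia.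
  have nE : n = (h * m)%N by nia.
  have m1 : (1 < m)%N by nia.
  have ha : (h %| a)%N by apply: dvdn_trans ta; rewrite th -muln2 dvdn_mulr.
  have st := steps_odd h0 odd_q nE (th : gcdn (2 * n) a = _).
  have [Hd Hn] := circulant_depth m1 (esym nE) ha a_ge1 a_lt_n (odd_q : false || odd m) st.
  have [dN _] := nonvanishing_not_exact K (@adj_sym _ _) (@adj_irr _ _) Hn.
  exists (2 * n - h * ladder_depth m false)%N; first exact: pdim_edge_ideal.
  split=> // _; rewrite /ladder_depth /= natrB // natrM natrM.
  have tQE : tQ = 2 * h%:R by rewrite /tQ th -mul2n natrM.
  have nQE : nQ = h%:R * m%:R by rewrite /nQ nE natrM.
  have hQ0 : h%:R != 0 :> rat by rewrite Num.Theory.pnatr_eq0 -lt0n.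
  split=> m4.
    have -> : (2 * nQ - tQ) / (2 * tQ) = (m.-1)%:R / 2.
      by rewrite -subn1 natrB ?(ltnW m1) // tQE nQE; field.
    rewrite ceil_half tQE -/nQ -pmulrn.
    have -> : ((m.+1 %/ 4).*2 = uphalf m.-1)%N by lia.
    by field.
  have -> : nQ / tQ = m%:R / 2 by rewrite tQE nQE; field.
  rewrite ceil_half tQE -/nQ -pmulrn.
  have -> : ((m.+1 %/ 4).*2 = uphalf m)%N by lia.
  by field.
have tn : (t %| n)%N.
  move: even_q t2n; rewrite -dvdn2 => /dvdnP[k kE] /divnK; rewrite kE => E.
  by apply/dvdnP; exists k; lia.
set m := (n %/ t)%N.
have nE : n = (m * t)%N by rewrite divnK.
have m1 : (1 < m)%N by nia.
have st := steps_even t0 (ltnW m1) nE (erefl : gcdn (2 * n) a = t).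
have tm : (t * m = n)%N by rewrite mulnC -nE.
have [Hd Hn] := circulant_depth m1 tm ta a_ge1 a_lt_n (isT : true || odd m) st.
have [dN _] := nonvanishing_not_exact K (@adj_sym _ _) (@adj_irr _ _) Hn.
exists (2 * n - t * ladder_depth m true)%N; first exact: pdim_edge_ideal.
split=> // _; rewrite /ladder_depth /= natrB // natrM natrM -/nQ -/tQ.
have nQE : nQ = m%:R * tQ by rewrite /nQ nE natrM.
have -> : nQ / (2 * tQ) = m%:R / 2 by rewrite nQE; field.
have -> : (nQ - tQ) / (2 * tQ) = (m.-1)%:R / 2.
  by rewrite -subn1 natrB ?(ltnW m1) // nQE; field.
rewrite !ceil_half -!pmulrn; case: ifP => m4.
  have -> : ((m %/ 4).*2 + (m %% 4 != 0) = uphalf m)%N by lia.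
  by ring.
have -> : ((m %/ 4).*2 + (m %% 4 != 0) = uphalf m.-1)%N by lia.
by ring.
Qed.
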